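(* Let $(a,\lambda,k)\in\mathbb R\times\sigma_D\times\mathbb Z_N$, let $\phi=\varphi'(1,\lambda)$, and let $\mathcal H_k^a(\lambda)=\{\psi\in\mathfrak D(H_k^a):H_k^a\psi=\lambda\psi\}$. (i) Every eigenfunction in $\mathcal H_k^a(\lambda)$ vanishes at all vertices of $\Gamma^1$. (ii) There exist $\psi^{(0,\nu)}=(\psi^{(0,\nu)}_{n,j})\in\mathcal H_k^a(\lambda)$, $\nu=1,2$, such that: - $\psi^{(0,\nu)}$ is supported in $\bigcup_{\ell\in\{0,1\}}\bigcup_{j=1}^6\Gamma_{\ell,j}$; - every shift $\psi^{(n,\nu)}$, defined by $\psi^{(n,\nu)}_{m,j}=\psi^{(0,\nu)}_{m-n,j}$, belongs to $\mathcal H_k^a(\lambda)$ for $n\in\mathbb Z$; - every $f\in\mathcal H_k^a(\lambda)$ satisfies $f=\sum_{(n,\nu)\in\mathbb Z\times\{1,2\}}\hat f_{n,\nu}\psi^{(n,\nu)}$ with $(\hat f_{n,1},\hat f_{n,2})_{n\in\mathbb Z}\in\ell^2\oplus\ell^2$. The coefficients are as follows: - If $(s_k,\phi^2)=(0,1)$, then $\hat f_{n,1}=f'_{n,1}(0)$ and $\hat f_{n,2}=f'_{n,2}(0)$. - If $(s_k,\phi^2)\neq(0,1)$, then $\tilde\varkappa_1=1-s^ke^{2ia}\phi^2\ne0$, $\tilde\varkappa_2=1-s^ke^{2ia}\phi^4\neq0$, and $$\hat f_{n,1}=\frac{f'_{n,5}(0)+s^k\phi e^{i(a+a_1)}f'_{n,6}(0)}{\tilde\varkappa_1\tilde\varkappa_2},\qquad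 \hat f_{n,2}=-\frac{e^{ia_1}f'_{n,6}(0)+\phi e^{ia}f'_{n,5}(0)}{\tilde\varkappa_1\tilde\varkappa_2}.$$ The map $f\mapsto(\hat f_{n,1},\hat f_{n,2})_{n\in\mathbb Z}$ is a linear isomorphism between $\mathcal H_k^a(\lambda)$ and $\ell^2\oplus\ell^2$.
   Context: Fix an integer $N\ge1$ and a real potential $q\in L^2(0,1)$. For $\lambda\in\mathbb C$, let $\vartheta(t,\lambda),\varphi(t,\lambda)$ solve $-y''+qy=\lambda y$ with $\vartheta(0)=\varphi'(0)=1$ and $\vartheta'(0)=\varphi(0)=0$. $\sigma_D$ is the Dirichlet spectrum of $-y''+qy=\lambda y$, $y(0)=y(1)=0$. Let $\Gamma^1$ be the graph with edges $\Gamma_{n,j}$, $(n,j)\in\mathbb Z\times\{1,\dots,6\}$, each identified with $[0,1]$, and $L^2(\Gamma^1)=\bigoplus L^2(0,1)$. The edges meet at vertices as encoded by the boundary conditions below: for each $n$, the endpoints $\Gamma_{n,1}(1),\Gamma_{n,2}(0),\Gamma_{n,5}(0)$ form a vertex, as do $\Gamma_{n,2}(1),\Gamma_{n,3}(0),\Gamma_{n,6}(0)$; $\Gamma_{n,3}(1),\Gamma_{n,4}(0),\Gamma_{n-1,6}(1)$; and $\Gamma_{n,4}(1),\Gamma_{n,1}(0),\Gamma_{n-1,5}(1)$. Let $a_1,a_2\in\mathbb R$, $a=a_1+a_2$, $s=e^{2\pi i/N}$, $k\in\mathbb Z_N$, and $s_k=\sin(\pi k/N+a)$. The boundary conditions (BC)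 for a family $f=(f_{n,j})$ are, for all $n\in\mathbb Z$: - $e^{ia_1}f_{n,1}(1)=f_{n,2}(0)=f_{n,5}(0)$; - $e^{ia_2}f_{n,2}(1)=f_{n,3}(0)=f_{n,6}(0)$; - $e^{ia_1}f_{n,3}(1)=f_{n,4}(0)=e^{ia_1}f_{n-1,6}(1)$; - $e^{ia_2}s^kf_{n,4}(1)=f_{n,1}(0)=e^{-ia_1}f_{n-1,5}(1)$; - $e^{ia_1}f'_{n,1}(1)-f'_{n,2}(0)-f'_{n,5}(0)=0$; - $e^{ia_2}f'_{n,2}(1)-f'_{n,3}(0)-f'_{n,6}(0)=0$; - $e^{ia_1}f'_{n,3}(1)-f'_{n,4}(0)+e^{ia_1}f'_{n-1,6}(1)=0$; - $e^{ia_2}s^kf'_{n,4}(1)-f'_{n,1}(0)+e^{-ia_1}f'_{n-1,5}(1)=0$. $H_k^a$ acts in $L^2(\Gamma^1)$ by $(H_k^af)_{n,j}=-f''_{n,j}+qf_{n,j}$ with domain $\mathfrak D(H_k^a)$ consisting of $f$ with $(f_{n,j}),(f''_{n,j})\in L^2(\Gamma^1)$ satisfying (BC). *)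

(* Defs.v *)
From HB Require Import structures.
From mathcomp Require Import all_boot all_order all_algebra.
From mathcomp Require Import all_classical all_reals all_analysis.
From mathcomp Require Import complex.
Set Implicit Arguments. Unset Strict Implicit. Unset Printing Implicit Defensive.
Import Order.TTheory GRing.Theory Num.Theory numFieldNormedType.Exports.
Local Open Scope classical_set_scope.
Local Open Scope ring_scope.

Section Defs.
Variable R : realType.

Local Notation mu := (@lebesgue_measure R).

Definition I01 : set R := `[0, 1].
Definition I0t (t : R) : set R := `[0, t].

Definition toC (x : R) : R[i] := Complex x 0.
Definition cexpi (th : R) : R[i] := Complex (cos th) (sin th).
Definition sqnormC (z : R[i]) : R := complex.Re z ^+ 2 + complex.Im z ^+ 2.

Definition L2_01 (q : R -> R) : Prop :=
  measurable_fun I01 q /\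
  (\int[mu]_(x in I01) ((q x) ^+ 2)%:E < +oo)%E.

Definition cint (t : R) (g : R -> R[i]) : R[i] :=
  Complex (\int[mu]_(x in (I0t t)) complex.Re (g x))
          (\int[mu]_(x in (I0t t)) complex.Im (g x)).

Definition cintegrable01 (g : R -> R[i]) : Prop :=
  mu.-integrable I01 (EFin \o (fun x => complex.Re (g x))) /\
  mu.-integrable I01 (EFin \o (fun x => complex.Im (g x))).

(** Real-valued H^2(0,1) solution of -y'' + q y = lam y on [0,1], with
    dy its (continuous) derivative: y, y' absolutely continuous,
    y'' = (q - lam) y a.e. *)
Definition ode_solR (q : R -> R) (lam : R) (y dy : R -> R) : Prop :=
  mu.-integrable I01 (EFin \o dy) /\
  mu.-integrable I01 (EFin \o (fun x => (q x - lam) * y x)) /\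
  (forall t, 0 <= t <= 1 ->
     y t = y 0 + \int[mu]_(x in (I0t t)) dy x /\
     dy t = dy 0 + \int[mu]_(x in (I0t t)) ((q x - lam) * y x)).

Definition ode_solC (q : R -> R) (lam : R) (u : R -> R[i]) : Prop :=
  exists du : R -> R[i],
    cintegrable01 du /\
    cintegrable01 (fun x => toC (q x - lam) * u x) /\
    (forall t, 0 <= t <= 1 ->
       u t = u 0 + cint t du /\
       du t = du 0 + cint t (fun x => toC (q x - lam) * u x)).

(** Dirichlet spectrum: lam such that -y''+qy = lam y, y(0)=y(1)=0 has a
    nontrivial solution (sigma_D is contained in R, q being real). *)
Definition sigmaD (q : R -> R) : set R :=
  [set lam | exists y dy : R -> R, ode_solR q lam y dy /\ y 0 = 0 /\ y 1 = 0 /\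
             exists t, 0 <= t <= 1 /\ y t != 0].

Definition rderivR (u : R -> R) : R := lim ((fun h => (u h - u 0) / h) @ 0^'+).
Definition lderivR (u : R -> R) : R := lim ((fun h => (u 1 - u (1 - h)) / h) @ 0^'+).
Definition d0 (u : R -> R[i]) : R[i] :=
  Complex (rderivR (fun x => complex.Re (u x))) (rderivR (fun x => complex.Im (u x))).
Definition d1 (u : R -> R[i]) : R[i] :=
  Complex (lderivR (fun x => complex.Re (u x))) (lderivR (fun x => complex.Im (u x))).

(** Functions on the graph Gamma^1: edges Gamma_{n,j}, n : int,
    j in {1..6} encoded as 'I_6 (edge j is ord j.-1). *)
Definition gfam := int -> 'I_6 -> R -> R[i].
Definition ed (j : nat) : 'I_6 := inord j.-1.

Definition fam_eq (f g : gfam) : Prop :=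
  forall n j t, 0 <= t <= 1 -> f n j t = g n j t.

Definition fam_L2 (f : gfam) : Prop :=
  (\esum_(p in [set: int * 'I_6])
     \int[mu]_(x in I01) (sqnormC (f p.1 p.2 x))%:E < +oo)%E.

Definition BC (N : nat) (a1 a2 : R) (k : 'I_N) (f : gfam) : Prop :=
  let sk := cexpi (2 * pi * k%:R / N%:R) in
  forall n : int,
  (cexpi a1 * f n (ed 1) 1 = f n (ed 2) 0 /\ f n (ed 2) 0 = f n (ed 5) 0) /\
      (cexpi a2 * f n (ed 2) 1 = f n (ed 3) 0 /\ f n (ed 3) 0 = f n (ed 6) 0) /\
      (cexpi a1 * f n (ed 3) 1 = f n (ed 4) 0 /\
        f n (ed 4) 0 = cexpi a1 * f (n - 1) (ed 6) 1) /\
      (cexpi a2 * sk * f n (ed 4) 1 = f n (ed 1) 0 /\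
        f n (ed 1) 0 = cexpi (- a1) * f (n - 1) (ed 5) 1) /\
      (cexpi a1 * d1 (f n (ed 1)) - d0 (f n (ed 2)) - d0 (f n (ed 5)) = 0) /\
      (cexpi a2 * d1 (f n (ed 2)) - d0 (f n (ed 3)) - d0 (f n (ed 6)) = 0) /\
      (cexpi a1 * d1 (f n (ed 3)) - d0 (f n (ed 4)) + cexpi a1 * d1 (f (n - 1) (ed 6)) = 0) /\
      (cexpi a2 * sk * d1 (f n (ed 4)) - d0 (f n (ed 1)) + cexpi (- a1) * d1 (f (n - 1) (ed 5)) = 0).

(** The eigsp H_k^a(lam) = { psi in D(H_k^a) : H_k^a psi = lam psi }:
    every edge function is in H^2(0,1) with psi'' = (q - lam) psi,
    (psi_{n,j}) in L^2(Gamma^1), (psi''_{n,j}) in L^2(Gamma^1), and (BC). *)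
Definition eigsp (q : R -> R) (N : nat) (a1 a2 : R) (k : 'I_N) (lam : R)
  : set gfam :=
  [set f | (forall n j, ode_solC q lam (f n j)) /\
           fam_L2 f /\
           fam_L2 (fun n j x => toC (q x - lam) * f n j x) /\
           BC a1 a2 k f].

Definition eshift (n : int) (psi : gfam) : gfam := fun m j => psi (m - n) j.

Definition l2Z (c : int -> R[i]) : Prop :=
  (\esum_(n in [set: int]) (sqnormC (c n))%:E < +oo)%E.

(** The coefficient map f |-> (hat f_{n,1}, hat f_{n,2}) of the theorem;
    ph = phi'(1, lam). *)
Definition fhat (N : nat) (a1 a2 : R) (k : 'I_N) (ph : R) (f : gfam)
  (nu : 'I_2) (n : int) : R[i] :=
  let a := a1 + a2 in
  let sk := cexpi (2 * pi * k%:R / N%:R) in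
  let s_k := sin (pi * k%:R / N%:R + a) in
  let kap1 := 1 - sk * cexpi (2 * a) * toC (ph ^+ 2) in
  let kap2 := 1 - sk * cexpi (2 * a) * toC (ph ^+ 4) in
  if (s_k == 0) && (ph ^+ 2 == 1) then
    (if nu == ord0 then d0 (f n (ed 1)) else d0 (f n (ed 2)))
  else
    (if nu == ord0 then
       (d0 (f n (ed 5)) + sk * toC ph * cexpi (a + a1) * d0 (f n (ed 6))) / (kap1 * kap2)
     else
       - ((cexpi a1 * d0 (f n (ed 6)) + toC ph * cexpi a * d0 (f n (ed 5))) / (kap1 * kap2))).

End Defs.

(* Main.v *)
Require Import Defs.
From HB Require Import structures.
From mathcomp Require Import all_boot all_order all_algebra.
From mathcomp Require Import all_classical all_reals all_analysis.
From mathcomp Require Import measurable_realfun complex.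
From mathcomp Require Import ring lra zify.
Import Order.TTheory GRing.Theory Num.Theory numFieldNormedType.Exports.
Local Open Scope classical_set_scope.
Local Open Scope ring_scope.

(* For a Dirichlet eigenvalue, varphi(1) = 0. Solutions are determined by their
   Cauchy data, so u(1) = c u(0) for every solution u on an edge, with a fixed
   constant c. The moduli of the vertex values of an eigenfunction are therefore
   multiplied by |c| along every edge; going around a cycle they vanish unless
   |c| = 1, and then they do not depend on n, which square summability excludes.
   Hence an eigenfunction is A n j * varphi on each edge, and what remains are the
   four Kirchhoff equations for the six square summable sequences A _ j. They are
   solved by finite-range formulas: in terms of A5, A6 if the two kappas do not
   vanish, and in terms of A1, A2 otherwise. *)

(** * Square summable sequences *)

(** The factor kappa_2 is one minus the multiplier collected along the cycle of edges 1, 2, 3, 4 of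
    a cell: eliminating A2, A3, A4 turns the fourth Kirchhoff equation into kappa_2 * A1 = a
    combination of A5, A6 at n and n - 1. The factor kappa_1 is, up to sign, the determinant of the
    passage from (A5, e1 * A6) to the unnormalised coefficients. Parametrising A5 and A6 as
    multiples of kappa_2 removes the division by kappa_2, so a coefficient at n acts on the cells n
    and n + 1 only; this is why two cells suffice as support. Since s^k e^{2ia} has modulus 1 and
    varphi'(1) is real, the two kappas vanish together or not at all. On the analytic side, varphi
    is given but no second solution is constructed. The constant c is read off from any solution
    with nonzero value at 0, if there is one; the same solution bounds |u(0)|^2 by the squared L^2
    norm of u, uniformly over the edges, and this is how square summability reaches the vertex
    values. *)

Section BoundedSums.
Context {R : realType}.

(** Finite sums over repetition-free lists stand in for the extended-real [\esum]: closure under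
    sums, multiples and injective reindexing becomes list manipulation, and [esum_lty_bounded]
    converts in both directions. *)
Definition bounded_sums {T : eqType} (g : T -> R) :=
  exists M : R, forall s : seq T, uniq s -> \sum_(i <- s) g i <= M.

Lemma esum_lty_bounded {T : choiceType} (g : T -> R) : (forall i, 0 <= g i) ->
  (\esum_(i in [set: T]) (g i)%:E < +oo)%E <-> bounded_sums g.
Proof.
move=> g0; split=> [oo|[M hM]].
  have fin : (\esum_(i in [set: T]) (g i)%:E)%E \is a fin_num.
    by rewrite ge0_fin_numE// esum_ge0// => i _; rewrite lee_fin.
  exists (fine (\esum_(i in [set: T]) (g i)%:E)%E) => s us.
  rewrite -lee_fin fineK// -sumEFin fsbig_seq//.
  by apply: esum_ge; exists [set` s] => //; split=> //; exact: finite_seq.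
apply: (@le_lt_trans _ _ M%:E); last exact: ltry.
apply: ge_ereal_sup => _ [A [finA _] <-].
by rewrite fsbig_finite//= sumEFin lee_fin hM.
Qed.

Lemma bounded_sums_le {T : eqType} (g h : T -> R) :
  (forall i, g i <= h i) -> bounded_sums h -> bounded_sums g.
Proof.
move=> gh [M hM]; exists M => s us; apply: le_trans (hM s us).
by apply: ler_sum.
Qed.

Lemma bounded_sumsZ {T : eqType} (r : R) (g : T -> R) : 0 <= r ->
  bounded_sums g -> bounded_sums (fun i => r * g i).
Proof.
move=> r0 [M hM]; exists (r * M) => s us.
by rewrite -mulr_sumr ler_wpM2l// hM.
Qed.

Lemma bounded_sumsD {T : eqType} (g h : T -> R) :
  bounded_sums g -> bounded_sums h -> bounded_sums (fun i => g i + h i).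
Proof.
move=> [M hM] [L hL]; exists (M + L) => s us.
by rewrite big_split /= lerD// ?hM ?hL.
Qed.

Lemma bounded_sums_comp {T U : eqType} (h : U -> T) (g : T -> R) :
  injective h -> bounded_sums g -> bounded_sums (g \o h).
Proof.
move=> hi [M hM]; exists M => s us.
by have := hM (map h s); rewrite big_map map_inj_uniq//; exact.
Qed.

Lemma bounded_sums_prod {T : eqType} {J : finType} (g : T -> J -> R) :
  (forall j, bounded_sums (g^~ j)) -> bounded_sums (fun p : T * J => g p.1 p.2).
Proof.
move=> /choice[M hM]; exists (\sum_j M j) => s us.
rewrite (partition_big (fun p => p.2) predT)//=.
apply: ler_sum => j _.
have -> : \sum_(i <- s | i.2 == j) g i.1 i.2 =
          \sum_(n <- [seq i.1 | i <- [seq i <- s | i.2 == j]]) g n j.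
  rewrite big_map big_filter; apply: eq_bigr => i /eqP <- //.
apply: hM; rewrite map_inj_in_uniq ?filter_uniq//.
move=> [n i] [m l]; rewrite !mem_filter /= => /andP[/eqP-> _] /andP[/eqP-> _].
by move=> ->.
Qed.

Lemma bounded_sums_const (g : int -> R) (d : R) : (forall n, g n = d) ->
  bounded_sums g -> d <= 0.
Proof.
move=> gd [M hM]; rewrite leNgt; apply/negP => d0.
have [n hn] : exists n : nat, M < d * n%:R.
  exists (Num.bound `|M / d|); rewrite mulrC -ltr_pdivrMr//.
  by rewrite (le_lt_trans (ler_norm _))// archi_boundP.
have := hM [seq Posz i | i <- iota 0 n].
rewrite map_inj_uniq ?iota_uniq// => [/(_ isT)|i j []//].
under eq_bigr do rewrite gd.
rewrite big_const_seq count_predT size_map size_iota iter_addr_0 -mulr_natr.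
by rewrite leNgt hn.
Qed.

End BoundedSums.

Section ComplexNumbers.
Context {R : realType}.
Implicit Types (z w : R[i]) (x y : R).

Lemma sqnormC_ge0 z : 0 <= sqnormC z.
Proof. by rewrite addr_ge0// sqr_ge0. Qed.

Lemma sqnormCM z w : sqnormC (z * w) = sqnormC z * sqnormC w.
Proof. by case: z w => a b [c d]; rewrite /sqnormC /=; ring. Qed.

Lemma sqnormC_toC x : sqnormC (toC x) = x ^+ 2.
Proof. by rewrite /sqnormC /= expr0n addr0. Qed.

Lemma sqnormCD_le z w : sqnormC (z + w) <= 2 * sqnormC z + 2 * sqnormC w.
Proof.
case: z w => a b [c d]; rewrite /sqnormC /=.
have := sqr_ge0 (a - c); have := sqr_ge0 (b - d); nra.
Qed.

Lemma sqnormC0 : sqnormC (0 : R[i]) = 0.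
Proof. by rewrite /sqnormC /= expr0n addr0. Qed.

Lemma sqnormC_eq0 z : sqnormC z = 0 -> z = 0.
Proof.
case: z => a b /eqP; rewrite /sqnormC /= paddr_eq0 ?sqr_ge0// !sqrf_eq0.
by move=> /andP[/eqP -> /eqP ->].
Qed.

Lemma sqnormC_cexpi x : sqnormC (cexpi x) = 1.
Proof. by rewrite /sqnormC /= cos2Dsin2. Qed.

Lemma cexpiD x y : cexpi (x + y) = cexpi x * cexpi y.
Proof.
rewrite /cexpi cosD sinD; apply/eqP; rewrite eq_complex /=.
by rewrite eqxx /= addrC [sin x * _]mulrC [cos x * sin y]mulrC mulrC [X in X + _]mulrC
   [sin y * _]mulrC.
Qed.

Lemma cexpi_neq0 x : cexpi x != 0.
Proof.
by apply/negP => /eqP c0; have := sqnormC_cexpi x;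
  rewrite c0 sqnormC0 => /esym/eqP; rewrite oner_eq0.
Qed.

Lemma cexpiN x : cexpi (- x) = (cexpi x)^-1.
Proof.
apply: (mulfI (cexpi_neq0 x)); rewrite -cexpiD subrr mulfV ?cexpi_neq0//.
by rewrite /cexpi cos0 sin0.
Qed.

Lemma toCX x (n : nat) : toC (x ^+ n) = toC x ^+ n.
Proof.
elim: n => [|n IH]; first by rewrite !expr0.
rewrite !exprS -IH; apply/eqP; rewrite eq_complex /=.
by rewrite !mul0r !mulr0 subr0 addr0 !eqxx.
Qed.

Lemma cexpi_double_sin0 x : sin x = 0 -> cexpi (2 * x) = 1.
Proof.
move=> sx; apply/eqP; rewrite eq_complex /= mulr2n mulrDl mul1r.
by rewrite cosD sinD sx !mulr0 mul0r addr0 subr0 eqxx andbT -expr2 cos2sin2 sx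
  expr0n subr0.
Qed.

Lemma cexpi_double_eq1 x : cexpi (2 * x) = 1 -> sin x = 0.
Proof.
move=> /eqP; rewrite eq_complex /= => /andP[/eqP + _].
rewrite mulr2n mulrDl mul1r cosD -expr2 cos2sin2 => h.
by apply/eqP; rewrite -sqrf_eq0; apply/eqP; nra.
Qed.

Definition sq_summable {T : eqType} (c : T -> R[i]) :=
  bounded_sums (fun i => sqnormC (c i)).

Lemma sq_summableD {T : eqType} (c d : T -> R[i]) :
  sq_summable c -> sq_summable d -> sq_summable (fun i => c i + d i).
Proof.
move=> hc hd; apply: (@bounded_sums_le _ _ _ (fun i => 2 * sqnormC (c i) + 2 * sqnormC (d i))).
  by move=> i; exact: sqnormCD_le.
by apply: bounded_sumsD; apply: bounded_sumsZ.
Qed.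

Lemma sq_summableZ {T : eqType} z (c : T -> R[i]) :
  sq_summable c -> sq_summable (fun i => z * c i).
Proof.
move=> hc; rewrite /sq_summable; under eq_fun do rewrite sqnormCM.
by apply: bounded_sumsZ => //; exact: sqnormC_ge0.
Qed.

Lemma sq_summable_shift (c : int -> R[i]) (m : int) :
  sq_summable c -> sq_summable (fun n => c (n - m)).
Proof.
by move=> hc; apply: (@bounded_sums_comp _ _ _ (fun n => n - m) _ _ hc); exact: addIr.
Qed.

(** Only the moduli are assumed constant, because vertex values may change by a phase from one cell
    to the next. *)
Lemma sq_summable_const (c : int -> R[i]) z :
  (forall n, sqnormC (c n) = sqnormC z) -> sq_summable c -> z = 0.
Proof.
move=> cz hc; apply: sqnormC_eq0; apply: le_anti.
by rewrite sqnormC_ge0 andbT; exact: bounded_sums_const cz hc.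
Qed.

End ComplexNumbers.

(** * Kirchhoff equations on the edges *)

Section EdgeAlgebra.
Context {R : realType}.
Implicit Types (e s p : R[i]).

Lemma edP (P : 'I_6 -> Prop) : P (ed 1) -> P (ed 2) -> P (ed 3) -> P (ed 4) ->
  P (ed 5) -> P (ed 6) -> forall j, P j.
Proof.
move=> ? ? ? ? ? ? j; have <- : ed (val j).+1 = j.
  by apply: val_inj; rewrite /ed /= inordK.
by case: j => -[|[|[|[|[|[|?]]]]]].
Qed.

Definition tab6 (x1 x2 x3 x4 x5 x6 : R[i]) (j : 'I_6) : R[i] :=
  nth 0 [:: x1; x2; x3; x4; x5; x6] j.

Lemma tab6E (x1 x2 x3 x4 x5 x6 : R[i]) :
  ((tab6 x1 x2 x3 x4 x5 x6 (ed 1) = x1) *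
  (tab6 x1 x2 x3 x4 x5 x6 (ed 2) = x2) *
  (tab6 x1 x2 x3 x4 x5 x6 (ed 3) = x3) *
  (tab6 x1 x2 x3 x4 x5 x6 (ed 4) = x4) *
  (tab6 x1 x2 x3 x4 x5 x6 (ed 5) = x5) *
  (tab6 x1 x2 x3 x4 x5 x6 (ed 6) = x6))%type.
Proof. by rewrite /tab6 /ed !inordK. Qed.

(* The derivative conditions of (BC) for edge functions [A n j * varphi], with
   [varphi'(0) = 1] and [p = varphi'(1)]. *)
Definition kirchhoff e1 e2 s p (A : int -> 'I_6 -> R[i]) := forall n : int,
  [/\ e1 * (A n (ed 1) * p) - A n (ed 2) - A n (ed 5) = 0,
      e2 * (A n (ed 2) * p) - A n (ed 3) - A n (ed 6) = 0,
      e1 * (A n (ed 3) * p) - A n (ed 4) + e1 * (A (n - 1) (ed 6) * p) = 0 &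
      e2 * s * (A n (ed 4) * p) - A n (ed 1) + e1^-1 * (A (n - 1) (ed 5) * p) = 0].

(* [u], [v] are the coefficients at [n] and [u'], [v'] those at [n - 1]. *)
Definition edge_generic e1 e2 s p (u v u' v' : R[i]) : 'I_6 -> R[i] :=
  let E := e1 * e2 in
  let k2 := 1 - s * E ^+ 2 * p ^+ 4 in
  let X := u + s * p * E * v in let Y := - (v + p * E * u) / e1 in
  let X' := u' + s * p * E * v' in let Y' := - (v' + p * E * u') / e1 in
  let A1 := E * s * p ^+ 2 * (Y' - Y - e2 * p * X) + p * X' / e1 in
  let A2 := e1 * p * A1 - k2 * X in
  let A3 := e2 * p * A2 - k2 * Y in
  tab6 A1 A2 A3 (e1 * p * (A3 + k2 * Y')) (k2 * X) (k2 * Y).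

(** Here [u] and [v] are the amplitudes on edges 1 and 2. Edge 6 is chosen to make the conserved
    quantity of [kirchhoff_degenerate] vanish; edges 5, 3 and 4 then follow from the first three
    Kirchhoff equations. *)
Definition edge_degenerate e1 e2 p (u v u' v' : R[i]) : 'I_6 -> R[i] :=
  let E := e1 * e2 in
  tab6 u v (E * u) (e1 * p * (E * u + e2 * p * v' - E * u')) (e1 * p * u - v)
       (e2 * p * v - E * u).

(** The values at unit vectors are the amplitudes of the generators: those of [u], [v] on cell 0,
    those of [u'], [v'] on cell 1. *)
Lemma edge_generic_linear e1 e2 s p (u v u' v' : R[i]) j :
  edge_generic e1 e2 s p u v u' v' j =
  edge_generic e1 e2 s p 1 0 0 0 j * u + edge_generic e1 e2 s p 0 1 0 0 j * v +
  edge_generic e1 e2 s p 0 0 1 0 j * u' + edge_generic e1 e2 s p 0 0 0 1 j * v'.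
Proof. by move: j; apply: edP; rewrite /edge_generic !tab6E; ring. Qed.

Lemma edge_degenerate_linear e1 e2 p (u v u' v' : R[i]) j :
  edge_degenerate e1 e2 p u v u' v' j =
  edge_degenerate e1 e2 p 1 0 0 0 j * u + edge_degenerate e1 e2 p 0 1 0 0 j * v +
  edge_degenerate e1 e2 p 0 0 1 0 j * u' + edge_degenerate e1 e2 p 0 0 0 1 j * v'.
Proof. by move: j; apply: edP; rewrite /edge_degenerate !tab6E; ring. Qed.

(** The first three equations define edges 2, 3 and 4 successively. The fourth becomes [k2] times
    [A1] on one side and a combination of edges 5 and 6 on the other, all of which carry the factor
    [k2]. *)
Lemma edge_generic_kirchhoff e1 e2 s p (c d : int -> R[i]) : e1 != 0 ->
  kirchhoff e1 e2 s p (fun n => edge_generic e1 e2 s p (c n) (d n) (c (n - 1)) (d (n - 1))).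
Proof. by move=> e10 n; rewrite /edge_generic !tab6E; split; field. Qed.

Lemma edge_degenerate_kirchhoff e1 e2 s p (c d : int -> R[i]) : e1 != 0 ->
  s * (e1 * e2) ^+ 2 = 1 -> p ^+ 2 = 1 ->
  kirchhoff e1 e2 s p (fun n => edge_degenerate e1 e2 p (c n) (d n) (c (n - 1)) (d (n - 1))).
Proof.
move=> e10 sE p2 n; rewrite /edge_degenerate !tab6E; split; try ring.
(* The fourth equation is the only one that uses the degeneracy; it is rearranged to exhibit
   [s * (e1 * e2) ^+ 2] and [p ^+ 2]. *)
have -> : forall x x' y' : R[i], e2 * s * (e1 * p * (e1 * e2 * x + e2 * p * y' - e1 * e2 * x') * p) - x +
   e1^-1 * ((e1 * p * x' - y') * p) = (s * (e1 * e2) ^+ 2) * (p ^+ 2) * (x - x' + e1^-1 * p * y')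
     - x + p ^+ 2 * x' - e1^-1 * p * y' by move=> *; field.
by rewrite sE p2; ring.
Qed.

(** With E = e1 * e2, the matrix with rows (1, s p E) and (- p E, -1) squares to [k1] times the
    identity. It sends (A5, e1 * A6) to the numerators of the coefficients, and edges 5 and 6 of
    [edge_generic] are [k2] times its value at (u, v). *)
Lemma generic_coefficients e1 e2 s p (u v u' v' : R[i]) (B := edge_generic e1 e2 s p u v u' v')
  (k1 := 1 - s * (e1 * e2) ^+ 2 * p ^+ 2) (k2 := 1 - s * (e1 * e2) ^+ 2 * p ^+ 4) :
  e1 != 0 -> k1 != 0 -> k2 != 0 ->
  (B (ed 5) + s * p * (e1 * e2 * e1) * B (ed 6)) / (k1 * k2) = u /\
  - ((e1 * B (ed 6) + p * (e1 * e2) * B (ed 5)) / (k1 * k2)) = v.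
Proof.
move=> e10 k10 k20; rewrite /B /edge_generic !tab6E -/k2.
by split; apply: (mulfI (mulf_neq0 k10 k20)); rewrite /k1; field; rewrite e10 k20 k10.
Qed.

(** The involution up to [k1] behind [generic_coefficients] recovers edges 5 and 6 from [c] and [d].
    As [k2] is nonzero, the equation around the cycle can then be solved for edge 1, and the other
    edges follow. *)
Lemma kirchhoff_generic e1 e2 s p (A : int -> 'I_6 -> R[i]) (n : int)
  (k1 := 1 - s * (e1 * e2) ^+ 2 * p ^+ 2) (k2 := 1 - s * (e1 * e2) ^+ 2 * p ^+ 4)
  (c := fun n => (A n (ed 5) + s * p * (e1 * e2 * e1) * A n (ed 6)) / (k1 * k2))
  (d := fun n => - ((e1 * A n (ed 6) + p * (e1 * e2) * A n (ed 5)) / (k1 * k2))) :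
  e1 != 0 -> k1 != 0 -> k2 != 0 -> kirchhoff e1 e2 s p A ->
  A n = edge_generic e1 e2 s p (c n) (d n) (c (n - 1)) (d (n - 1)).
Proof.
move=> e10 k10 k20 /(_ n)[h1 h2 h3 h4].
have h5 m : A m (ed 5) = k2 * (c m + s * p * (e1 * e2) * d m).
  by rewrite /c /d /k1; field; rewrite k20 k10.
have h6 m : A m (ed 6) = k2 * (- (d m + p * (e1 * e2) * c m) / e1).
  by rewrite /c /d /k1; field; rewrite k20 k10 e10.
have h2' : A n (ed 2) = e1 * p * A n (ed 1) - A n (ed 5).
  by apply/eqP; rewrite -subr_eq0 -oppr_eq0 -h1; apply/eqP; ring.
have h3' : A n (ed 3) = e2 * p * A n (ed 2) - A n (ed 6).
  by apply/eqP; rewrite -subr_eq0 -oppr_eq0 -h2; apply/eqP; ring.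
have h4' : A n (ed 4) = e1 * p * (A n (ed 3) + A (n - 1) (ed 6)).
  by apply/eqP; rewrite -subr_eq0 -oppr_eq0 -h3; apply/eqP; ring.
have h1' : A n (ed 1) = e1 * e2 * s * p ^+ 2 *
    (- (d (n - 1) + p * (e1 * e2) * c (n - 1)) / e1 - - (d n + p * (e1 * e2) * c n) / e1 -
     e2 * p * (c n + s * p * (e1 * e2) * d n)) +
   p * (c (n - 1) + s * p * (e1 * e2) * d (n - 1)) / e1.
  apply: (mulfI k20); apply/eqP; rewrite -subr_eq0 -oppr_eq0 -h4 h4' h3' h2' !h5 !h6.
  by apply/eqP; rewrite /k2; field.
by apply/funext; apply: edP; rewrite /edge_generic !tab6E -/k2 ?h4' ?h3' ?h2' ?h5 ?h6 ?h1'.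
Qed.

(* Telescoping: [A1 - p e1^-1 A2 + (e1 e2)^-1 A6] does not depend on [n], so it
   vanishes by square summability. *)
Lemma kirchhoff_degenerate e1 e2 s p (A : int -> 'I_6 -> R[i]) (n : int) :
  e1 != 0 -> e2 != 0 -> s * (e1 * e2) ^+ 2 = 1 -> p ^+ 2 = 1 ->
  kirchhoff e1 e2 s p A -> (forall j, sq_summable (A ^~ j)) ->
  A n = edge_degenerate e1 e2 p (A n (ed 1)) (A n (ed 2)) (A (n - 1) (ed 1)) (A (n - 1) (ed 2)).
Proof.
move=> e10 e20 sE p2 K sA.
have sE' : s = (e1 * e2) ^- 2.
  by apply: (mulIf (expf_neq0 2 (mulf_neq0 e10 e20))); rewrite sE mulVf// expf_neq0// mulf_neq0.
pose B m := A m (ed 6) + (e1 * e2 * A m (ed 1) + - (e2 * p) * A m (ed 2)).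
have BS m : B m = B (m - 1).
  have [h1 h2 h3 h4] := K m; have [h1' h2' _ _] := K (m - 1).
  have H5 : A (m - 1) (ed 5) = e1 * p * A (m - 1) (ed 1) - A (m - 1) (ed 2).
    by apply/eqP; rewrite -subr_eq0 -oppr_eq0 -h1'; apply/eqP; ring.
  have H3 : A m (ed 3) = e2 * p * A m (ed 2) - A m (ed 6).
    by apply/eqP; rewrite -subr_eq0 -oppr_eq0 -h2; apply/eqP; ring.
  have H4 : A m (ed 4) = e1 * p * (A m (ed 3) + A (m - 1) (ed 6)).
    by apply/eqP; rewrite -subr_eq0 -oppr_eq0 -h3; apply/eqP; ring.
  have : e1 * e2 * (s * (e1 * e2) ^+ 2 * p ^+ 2 / (e1 * e2) * (A m (ed 3) + A (m - 1) (ed 6)) -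
      A m (ed 1) + p ^+ 2 * A (m - 1) (ed 1) - e1^-1 * p * A (m - 1) (ed 2)) = 0.
    rewrite -[RHS](mulr0 (e1 * e2)) -h4 H4 H5; congr (_ * _); field; exact/andP.
  rewrite sE p2 H3 => /eqP; rewrite -oppr_eq0 => h.
  apply/eqP; rewrite -subr_eq0 -(eqP h) /B; apply/eqP; field; exact/andP.
have Bcst m : B m = B 0.
  elim/int_rect: m => [//|m IH|m IH].
    by rewrite BS -IH; congr B; lia.
  by rewrite -IH [RHS]BS; congr B; lia.
have B0 : B 0 = 0.
  apply: (@sq_summable_const _ B) => [m|]; first by rewrite Bcst.
  by apply: sq_summableD => //; apply: sq_summableD; apply: sq_summableZ.
have H6 m : A m (ed 6) = e2 * p * A m (ed 2) - e1 * e2 * A m (ed 1).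
  by apply/eqP; rewrite -subr_eq0 -B0 -(Bcst m); apply/eqP; rewrite /B; ring.
have [h1 h2 h3 h4] := K n.
have H3 : A n (ed 3) = e1 * e2 * A n (ed 1).
  by apply/eqP; rewrite -subr_eq0 -oppr_eq0 -h2 H6; apply/eqP; ring.
apply/funext; apply: edP; rewrite /edge_degenerate !tab6E //.
- by apply/eqP; rewrite -subr_eq0 -oppr_eq0 -h3 H6 H3; apply/eqP; ring.
- by apply/eqP; rewrite -subr_eq0 -oppr_eq0 -h1; apply/eqP; ring.
Qed.

End EdgeAlgebra.

(** * Solutions of the differential equation *)

Section RealODE.
Context {R : realType}.
Local Notation mu := (@lebesgue_measure R).
Implicit Types (q y z dy dz f g : R -> R) (lam : R).

Local Hint Extern 0 (measurable (I0t _)) => exact: measurable_itv : core.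
Local Hint Extern 0 (measurable (@I01 _)) => exact: measurable_itv : core.

Lemma I0t_sub01 (t : R) : t <= 1 -> I0t t `<=` @I01 R.
Proof. by move=> t1; apply: subset_itvl; rewrite bnd_simp. Qed.

Lemma integrable_cst01 (c : R) : mu.-integrable (@I01 R) (EFin \o cst c).
Proof.
apply: continuous_compact_integrable; first exact: segment_compact.
by apply: continuous_subspaceT => x; exact: cvg_cst.
Qed.

Lemma Rintegral_I0tB f (s t : R) : 0 <= s -> s <= t -> t <= 1 ->
  mu.-integrable (@I01 R) (EFin \o f) ->
  \int[mu]_(x in I0t t) f x - \int[mu]_(x in I0t s) f x =
  \int[mu]_(x in `]s, t]) f x.
Proof.
move=> s0 st t1 intf; apply: Rintegral_itvB; rewrite ?bnd_simp//.
by apply: integrableS intf => //; exact: I0t_sub01.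
Qed.

(** Used in three ways: [c = 0] gives Lipschitz bounds, [c] the value of [dy] at an endpoint gives
    one-sided derivatives, and [c] the midpoint of a range of values gives a lower bound for an
    integral. *)
Lemma Rintegral_I0t_slope f (s t c e : R) : 0 <= s -> s <= t -> t <= 1 ->
  mu.-integrable (@I01 R) (EFin \o f) ->
  (forall x, s <= x <= t -> `|f x - c| <= e) ->
  `|\int[mu]_(x in I0t t) f x - \int[mu]_(x in I0t s) f x - c * (t - s)| <= e * (t - s).
Proof.
move=> s0 st t1 intf fC; rewrite Rintegral_I0tB//.
have sub : `]s, t] `<=` @I01 R.
  by apply: subset_itv; rewrite bnd_simp// ltW.
have int' g : mu.-integrable (@I01 R) (EFin \o g) -> mu.-integrable `]s, t] (EFin \o g).
  by move=> ig; apply: integrableS ig => //; exact: sub.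
have muE : mu [set` `]s, t]] = (t - s)%:E.
  rewrite lebesgue_measure_itv/= lte_fin; case: ltP => [//|ts].
  have -> : t = s by apply/le_anti/andP.
  by rewrite subrr.
have cstE d : d * (t - s) = \int[mu]_(x in `]s, t]) (cst d x).
  by rewrite Rintegral_cst//; congr (_ * _); exact: (congr1 fine (esym muE)).
rewrite !cstE -RintegralB//; [|exact: int'|exact/int'/integrable_cst01].
have ifc : mu.-integrable `]s, t] (EFin \o (fun x => f x - cst c x)).
  apply: int'; exact: (@integrableB _ _ _ mu (@I01 R) (measurable_itv _) _
    (EFin \o cst c) intf (integrable_cst01 c)).
apply: le_trans (le_normr_Rintegral _ ifc) _ => //.
apply: le_Rintegral => //; [|exact/int'/integrable_cst01|].
  exact: integrable_norm.
move=> x /=; rewrite in_itv/= => /andP[sx xt]; apply: fC.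
by rewrite xt ltW.
Qed.

Lemma potential_sqr_integrable q : L2_01 q ->
  mu.-integrable (@I01 R) (EFin \o (fun x => q x ^+ 2)).
Proof.
move=> [mq q2]; apply/integrableP; split; first exact/measurable_EFinP/measurable_funX.
apply: le_lt_trans q2; rewrite le_eqVlt; apply/orP; left; apply/eqP.
by apply: eq_integral => x _ /=; rewrite ger0_norm// sqr_ge0.
Qed.

(** On an interval of finite length the pointwise bound |q| <= q^2 + 1 suffices. *)
Lemma potential_integrable q lam : L2_01 q ->
  mu.-integrable (@I01 R) (EFin \o (fun x => q x - lam)).
Proof.
move=> Hq; have iq2 := potential_sqr_integrable q Hq; case: Hq => mq _.
have iq2c := @integrableD _ _ _ mu (@I01 R) (measurable_itv _) _ _ iq2 (integrable_cst01 (1 + `|lam|)).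
apply: le_integrable iq2c => //.
  by apply/measurable_EFinP; apply: measurable_funB.
move=> x _ /=; rewrite lee_fin.
rewrite [leRHS]ger0_norm; last by rewrite addr_ge0 ?sqr_ge0// addr_ge0.
apply: le_trans (ler_normB _ _) _; rewrite addrA lerD2r.
have -> : q x ^+ 2 = `|q x| ^+ 2 by rewrite real_normK// num_real.
have := sqr_ge0 (`|q x| - 2^-1); nra.
Qed.

Lemma primitive_continuous (f F : R -> R) (c : R) :
  mu.-integrable (@I01 R) (EFin \o f) ->
  (forall t, 0 <= t <= 1 -> F t = c + \int[mu]_(x in I0t t) f x) ->
  {within `[0, 1], continuous F}.
Proof.
move=> intf hF.
apply: (@subspace_eq_continuous _ _ _ (fun t => c + \int[mu]_(x in I0t t) f x)).
  by move=> t; rewrite inE /= in_itv/= => /hF/esym.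
apply: within_continuousD; first by apply: continuous_subspaceT => x; exact: cvg_cst.
exact: parameterized_integral_continuous.
Qed.

Lemma continuous01_bounded f : {within `[0, 1], continuous f} ->
  exists2 M, 0 <= M & forall t, 0 <= t <= 1 -> `|f t| <= M.
Proof.
move=> cf; have cont : {within `[0, 1], continuous (fun x => `|f x|)}.
  by move=> x; apply: cvg_norm; exact: cf.
have [c _ cmax] := EVT_max ler01 cont.
by exists `|f c| => // t t01; apply: cmax; rewrite in_itv.
Qed.

Section Solution.
Variables (q y dy : R -> R) (lam : R).
Hypothesis Hq : L2_01 q.
Hypothesis sol : ode_solR q lam y dy.

Let Q := \int[mu]_(x in @I01 R) `|q x - lam|.

Let Q0 : 0 <= Q. Proof. by apply: Rintegral_ge0 => x _. Qed.

Lemma sol_slope (s t c e : R) : 0 <= s -> s <= t -> t <= 1 ->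
  (forall x, s <= x <= t -> `|dy x - c| <= e) ->
  `|y t - y s - c * (t - s)| <= e * (t - s).
Proof.
case: sol => idy [_ h] s0 st t1 dC.
have [-> _] := h t (introT andP (conj (le_trans s0 st) t1)).
have [-> _] := h s (introT andP (conj s0 (le_trans st t1))).
have -> : forall a b c : R, a + b - (a + c) = b - c by move=> *; ring.
exact: Rintegral_I0t_slope.
Qed.

Lemma sol_Lipschitz (s t C : R) : 0 <= s -> s <= t -> t <= 1 ->
  (forall x, s <= x <= t -> `|dy x| <= C) -> `|y t - y s| <= C * (t - s).
Proof.
move=> s0 st t1 dC; have := @sol_slope s t 0 C s0 st t1.
by rewrite mul0r subr0; apply=> x /dC; rewrite subr0.
Qed.

Lemma sol_derivative_bound (t M : R) : 0 <= t -> t <= 1 ->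
  (forall x, 0 <= x <= t -> `|y x| <= M) -> `|dy t - dy 0| <= M * Q.
Proof.
case: sol => _ [ipy h] t0 t1 yM.
have [_ ->] := h t (introT andP (conj t0 t1)).
rewrite addrC addKr.
have M0 : 0 <= M by rewrite (le_trans _ (yM 0 _))// lexx.
have ip := integrable_norm (potential_integrable q lam Hq).
have int' g : mu.-integrable (@I01 R) (EFin \o g) -> mu.-integrable (I0t t) (EFin \o g).
  by move=> ig; apply: integrableS ig => //; exact: I0t_sub01.
apply: le_trans (le_normr_Rintegral _ (int' _ ipy)) _ => //.
apply: (@le_trans _ _ (\int[mu]_(x in I0t t) (M * `|q x - lam|))).
  apply: le_Rintegral => //; first exact/integrable_norm/int'.
    by apply: int'; apply: (@integrableZl _ _ _ mu (@I01 R) (measurable_itv _) M _ ip).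
  move=> x; rewrite /I0t /= in_itv/= normrM mulrC => xt.
  by rewrite ler_wpM2r// yM.
rewrite RintegralZl//; last exact: int'.
rewrite ler_wpM2l// /Q /Rintegral fine_le//.
- by apply: integrable_fin_num => //; exact: int'.
- exact: integrable_fin_num.
- apply: ge0_subset_integral => //.
  + exact: measurable_int ip.
  + exact: I0t_sub01.
Qed.

Lemma sol_continuous : {within `[0, 1], continuous y}.
Proof.
by case: sol => idy [_ h]; apply: (primitive_continuous _ _ (y 0) idy) => t /h[].
Qed.

Lemma sol_derivative_continuous : {within `[0, 1], continuous dy}.
Proof.
by case: sol => _ [ipy h]; apply: (primitive_continuous _ _ (dy 0) ipy) => t /h[].
Qed.

(** A stepwise contraction argument: [h] is so small that [Q * h] is at most 1/2, and vanishing
    passes from [[0, k * h]] to [[0, (k + 1) * h]]. *)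
Lemma sol_unique : y 0 = 0 -> dy 0 = 0 -> forall t, 0 <= t <= 1 -> y t = 0.
Proof.
move=> y0 dy0.
pose n := (Num.bound (2 * Q)).+1.
pose h : R := n%:R^-1.
have n0 : 0 < n%:R :> R by rewrite ltr0n.
have h0 : 0 < h by rewrite invr_gt0.
have hQ : Q * h <= 2^-1.
  rewrite ler_pdivrMr// mulrC ler_pdivlMr// mulrC /n.
  rewrite ltW// (lt_trans (archi_boundP _))// ?mulr_ge0// ltr_nat.
  by [].
suff : forall k : nat, forall t, 0 <= t <= 1 -> t <= k%:R * h -> y t = 0.
  move=> /(_ n) H t t01; apply: H => //.
  by rewrite mulfV ?gt_eqF//; case/andP: t01.
elim=> [t /andP[t0 _]|k IH t /andP[t0 t1] tk].
  by rewrite mul0r => t0'; have -> : t = 0 by apply/le_anti/andP.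
have cont : {within `[0, t], continuous (fun x => `|y x|)}.
  have cy : {within `[0, t], continuous y}.
    apply: continuous_subspaceW sol_continuous.
    by apply: subset_itvl; rewrite bnd_simp.
  by move=> x; apply: cvg_norm; exact: cy.
have [c + cmax] := EVT_max t0 cont.
rewrite in_itv/= => /andP[c0 ct].
have c1 := le_trans ct t1.
(* Since [dy 0 = 0], the derivative is bounded by [|y c| * Q] on [[0, c]]. As [y] vanishes at
   [k * h], this gives |y c| <= |y c| Q (c - k h), with c - k h <= h. *)
have key : `|y c| <= `|y c| / 2.
  have [ck|kc] := leP c (k%:R * h).
    by rewrite IH ?c0// normr0 mul0r.
  have k0 : 0 <= k%:R * h by rewrite mulr_ge0// ltW.
  have yk : y (k%:R * h) = 0 by apply: IH => //; rewrite k0 (le_trans (ltW kc)).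
  have := @sol_Lipschitz (k%:R * h) c (`|y c| * Q) k0 (ltW kc) c1.
  rewrite yk subr0 => /(_ _)/le_trans; apply.
    move=> x /andP[kx xc]; have := @sol_derivative_bound x `|y c|.
    rewrite dy0 subr0; apply.
    - exact: le_trans kx.
    - exact: le_trans c1.
    - move=> z /andP[z0 zx]; apply: cmax; rewrite in_itv/= z0/=.
      by rewrite (le_trans zx)// (le_trans xc).
  rewrite -mulrA ler_wpM2l//; apply: le_trans hQ.
  rewrite ler_wpM2l//.
  move: tk; rewrite -natr1 mulrDl mul1r => tk; lra.
have y0c : `|y c| = 0 by have := normr_ge0 (y c); lra.
apply/eqP; rewrite -normr_le0 -y0c; apply: cmax.
by rewrite in_itv/= t0 lexx.
Qed.

(** The boundary conditions use limits of difference quotients, whereas [dy] comes from the integral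
    equations; continuity of [dy] makes the two agree at an endpoint. *)
Lemma sol_right_derivative : (y h - y 0) / h @[h --> 0^'+] --> dy 0.
Proof.
have /(continuous_within_itvP _ ltr01)[_ + _] := sol_derivative_continuous.
move=> /cvgrPdist_le c0; apply/cvgrPdist_le => e e0.
have [d /= d0 hd] := c0 e e0.
near=> h.
have h0 : 0 < h by near: h; exact: nbhs_right_gt.
have hlt : h < d by near: h; exact: nbhs_right_lt.
have h1 : h <= 1 by near: h; apply: nbhs_right_le.
have := @sol_slope 0 h (dy 0) e (lexx _) (ltW h0) h1.
rewrite subr0 => /(_ _)/wrap[x /andP[x0 xh]|H].
  rewrite distrC; move: x0; rewrite le_eqVlt => /predU1P[<-|x0].
    by rewrite subrr normr0 ltW.
  apply: hd => //=; rewrite sub0r normrN gtr0_norm//.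
  exact: le_lt_trans hlt.
rewrite distrC -[X in `|_ - X|](mulfK (lt0r_neq0 h0)) -mulrBl normrM normfV (gtr0_norm h0).
by rewrite ler_pdivrMr.
Unshelve. all: by end_near. Qed.

Lemma sol_left_derivative : (y 1 - y (1 - h)) / h @[h --> 0^'+] --> dy 1.
Proof.
have /(continuous_within_itvP _ ltr01)[_ _ +] := sol_derivative_continuous.
move=> /cvgrPdist_le c0; apply/cvgrPdist_le => e e0.
have [d /= d0 hd] := c0 e e0.
near=> h.
have h0 : 0 < h by near: h; exact: nbhs_right_gt.
have hlt : h < d by near: h; exact: nbhs_right_lt.
have h1 : h <= 1 by near: h; apply: nbhs_right_le.
have := @sol_slope (1 - h) 1 (dy 1) e.
rewrite subr_ge0 gerBl subKr => /(_ h1 (ltW h0) (lexx _) _)/wrap[x /andP[x0 xh]|H].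
  rewrite distrC; move: xh; rewrite le_eqVlt => /predU1P[->|xh].
    by rewrite subrr normr0 ltW.
  apply: hd => //=; rewrite gtr0_norm ?subr_gt0//.
  by apply: le_lt_trans hlt; lra.
rewrite distrC -[X in `|_ - X|](mulfK (lt0r_neq0 h0)) -mulrBl normrM normfV (gtr0_norm h0).
by rewrite ler_pdivrMr.
Unshelve. all: by end_near. Qed.

Lemma sol_measurable : measurable_fun (@I01 R) y.
Proof.
by apply: subspace_continuous_measurable_fun; [exact: measurable_itv|exact: sol_continuous].
Qed.

Lemma sol_bounded : exists2 M, 0 <= M & forall t, 0 <= t <= 1 -> `|y t| <= M.
Proof. exact/continuous01_bounded/sol_continuous. Qed.

End Solution.

Lemma sol_product_integrable (q y dy z dz : R -> R) lam :
  ode_solR q lam y dy -> ode_solR q lam z dz ->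
  mu.-integrable (@I01 R) (EFin \o (fun x => y x * z x)).
Proof.
move=> /sol_continuous cy /sol_continuous cz.
apply: continuous_compact_integrable; first exact: segment_compact.
by move=> x; apply: cvgM; [exact: cy|exact: cz].
Qed.

Lemma integrable_lin f g (a b : R) : 
  mu.-integrable (@I01 R) (EFin \o f) -> mu.-integrable (@I01 R) (EFin \o g) ->
  mu.-integrable (@I01 R) (EFin \o (fun x => a * f x + b * g x)).
Proof.
move=> fi gi.
apply: (@integrableD _ _ _ mu (@I01 R) (measurable_itv _) (EFin \o (fun x => a * f x)) (EFin \o (fun x => b * g x))).
  exact: (@integrableZl _ _ _ mu (@I01 R) (measurable_itv _) a _ fi).
exact: (@integrableZl _ _ _ mu (@I01 R) (measurable_itv _) b _ gi).
Qed.

Lemma Rintegral_lin f g (a b t : R) : t <= 1 ->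
  mu.-integrable (@I01 R) (EFin \o f) -> mu.-integrable (@I01 R) (EFin \o g) ->
  \int[mu]_(x in I0t t) (a * f x + b * g x) =
  a * \int[mu]_(x in I0t t) f x + b * \int[mu]_(x in I0t t) g x.
Proof.
move=> t1 fi gi.
have int' h : mu.-integrable (@I01 R) (EFin \o h) -> mu.-integrable (I0t t) (EFin \o h).
  by move=> ig; apply: integrableS ig => //; exact: I0t_sub01.
have fi' := int' _ fi; have gi' := int' _ gi.
rewrite RintegralD//.
- by rewrite !RintegralZl.
- exact: (@integrableZl _ _ _ mu (I0t t) (measurable_itv _) a _ fi').
- exact: (@integrableZl _ _ _ mu (I0t t) (measurable_itv _) b _ gi').
Qed.

Lemma ode_solR_lin q lam y dy z dz (a b : R) :
  ode_solR q lam y dy -> ode_solR q lam z dz ->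
  ode_solR q lam (fun x => a * y x + b * z x) (fun x => a * dy x + b * dz x).
Proof.
move=> [iy [ipy hy]] [iz [ipz hz]].
have E : (fun x => (q x - lam) * (a * y x + b * z x)) =
         (fun x => a * ((q x - lam) * y x) + b * ((q x - lam) * z x)).
  by apply/funext => x; ring.
split; first exact: integrable_lin.
rewrite E; split; first exact: integrable_lin.
move=> t t01; have t1 : t <= 1 by case/andP: t01.
have [-> ->] := hy t t01; have [-> ->] := hz t t01.
by rewrite !Rintegral_lin//; split; ring.
Qed.

(** A Lipschitz bound keeps |y| above half of |y t0| on an interval around [t0], and this interval
    alone contributes a positive amount. *)
Lemma sol_square_pos q lam y dy : ode_solR q lam y dy ->
  (exists2 t, 0 <= t <= 1 & y t != 0) -> 0 < \int[mu]_(x in @I01 R) (y x * y x).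
Proof.
move=> sol [t0 t001 yt0].
have [M M0 hM] := sol_bounded q y dy lam sol.
have [C C0 hC] := continuous01_bounded _ (sol_derivative_continuous q y dy lam sol).
have lip (x : R) : 0 <= x <= 1 -> `|y x - y t0| <= C * `|x - t0|.
  move=> /andP[x0 x1]; case/andP: t001 => t00 t01.
  have [xt|tx] := leP x t0.
    rewrite distrC [X in _ * X]distrC [X in _ * X]ger0_norm ?subr_ge0//.
    apply: (sol_Lipschitz q y dy lam sol) => // u /andP[u0 u1]; apply: hC.
    by rewrite (le_trans x0)// (le_trans u1).
  rewrite [X in _ * X]gtr0_norm ?subr_gt0//.
  apply: (sol_Lipschitz q y dy lam sol) => //; first exact: ltW.
  move=> u /andP[u0 u1]; apply: hC.
  by rewrite (le_trans t00)// (le_trans u1).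
(* [C] is a Lipschitz constant and may be 0, hence [C + 1] in the denominator. *)
pose d := `|y t0| / (2 * (C + 1)).
have yt0' : 0 < `|y t0| by rewrite normr_gt0.
have C1 : 0 < 2 * (C + 1) by lra.
have d0 : 0 < d by rewrite divr_gt0.
pose m := (`|y t0| / 2) ^+ 2.
have m0 : 0 < m by rewrite exprn_gt0// divr_gt0.
have lower (x : R) : 0 <= x <= 1 -> `|x - t0| <= d -> m <= y x * y x <= M * M.
  move=> x01 xd; apply/andP; split; last first.
    by rewrite -expr2 -(real_normK (num_real _)) expr2 ler_pM// hM.
  rewrite -expr2 -(real_normK (num_real (y x))) /m ler_pXn2r ?nnegrE// ?divr_ge0//.
  have h1 : `|y x - y t0| <= `|y t0| / 2.
    apply: le_trans (lip x x01) _; apply: (@le_trans _ _ ((C + 1) * d)).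
      by rewrite ler_pM// lerDl.
    rewrite /d le_eqVlt; apply/orP; left; apply/eqP; field; lra.
  have h2 := ler_normD (y t0 - y x) (y x); rewrite subrK distrC in h2; lra.
pose s := Num.max 0 (t0 - d); pose t := Num.min 1 (t0 + d).
have [t00 t01] := andP t001.
have s0 : 0 <= s by rewrite le_max lexx.
have t1 : t <= 1 by rewrite ge_min lexx.
have st : s < t by rewrite lt_min !gt_max ltr01 /=; apply/and3P; split; lra.
have stb (x : R) : s <= x <= t -> m <= y x * y x <= M * M.
  move=> /andP[]; rewrite ge_max le_min => /andP[x0 xd] /andP[x1 xd'].
  by apply: lower; [rewrite x0|rewrite ler_norml; apply/andP; split; lra].
have iyy := sol_product_integrable _ _ _ _ _ _ sol sol.
(* Taking midpoint and half-length of the range [[m, M * M]] as [c] and [e], the lower half of the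
   slope estimate says that the integral over [[s, t]] is at least [m * (t - s)]. *)
have := @Rintegral_I0t_slope (fun x => y x * y x) s t ((m + M * M) / 2) ((M * M - m) / 2)
  s0 (ltW st) t1 iyy.
move=> /(_ _)/wrap[x /stb /andP[h1 h2]|]; first by rewrite ler_norml; apply/andP; split; lra.
rewrite ler_norml => /andP[h _].
have pos D : 0 <= \int[mu]_(x in D) (y x * y x).
  by apply: Rintegral_ge0 => x _; rewrite -expr2 sqr_ge0.
have := pos (I0t s); have := pos `]t, 1]%classic.
rewrite -Rintegral_I0tB//; last by rewrite (le_trans s0)// ltW.
have : 0 < m * (t - s) by rewrite mulr_gt0// subr_gt0.
change (@I01 R) with (@I0t R 1); lra.
Qed.

End RealODE.

(** * Complex-valued solutions on an edge and their endpoint derivatives *)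

Section ComplexSolutions.
Context {R : realType}.
Local Notation mu := (@lebesgue_measure R).

Local Hint Extern 0 (measurable (@I01 _)) => exact: measurable_itv : core.

Lemma Re_toCM (r : R) (z : R[i]) : complex.Re (toC r * z) = r * complex.Re z.
Proof. by case: z => a b /=; rewrite mul0r subr0. Qed.

Lemma Im_toCM (r : R) (z : R[i]) : complex.Im (toC r * z) = r * complex.Im z.
Proof. by case: z => a b /=; rewrite mul0r addr0. Qed.

Lemma Re_MtoC (z : R[i]) (r : R) : complex.Re (z * toC r) = complex.Re z * r.
Proof. by rewrite mulrC Re_toCM mulrC. Qed.

Lemma Im_MtoC (z : R[i]) (r : R) : complex.Im (z * toC r) = complex.Im z * r.
Proof. by rewrite mulrC Im_toCM mulrC. Qed.

Lemma complexP (z w : R[i]) : complex.Re z = complex.Re w ->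
  complex.Im z = complex.Im w -> z = w.
Proof. by case: z w => a b [c d] /= -> ->. Qed.

Variables (q : R -> R) (lam : R).
Hypothesis Hq : L2_01 q.

Lemma ode_solC_split (u : R -> R[i]) : ode_solC q lam u ->
  exists dy dz, ode_solR q lam (fun x => complex.Re (u x)) dy /\
                ode_solR q lam (fun x => complex.Im (u x)) dz.
Proof.
move=> [du [[i1 i2] [[p1 p2] h]]].
have eR : (fun x => complex.Re (toC (q x - lam) * u x)) = (fun x => (q x - lam) * complex.Re (u x)).
  by apply/funext => x; rewrite Re_toCM.
have eI : (fun x => complex.Im (toC (q x - lam) * u x)) = (fun x => (q x - lam) * complex.Im (u x)).
  by apply/funext => x; rewrite Im_toCM.
exists (fun x => complex.Re (du x)), (fun x => complex.Im (du x)).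
split; (split; [|split] => //; [by rewrite ?eR ?eI in p1 p2 *|]); move=> t /h[].
- by rewrite /cint eR; move=> /(congr1 (@complex.Re R))/= -> /(congr1 (@complex.Re R))/= ->;
    rewrite !raddfD /=.
- by rewrite /cint eI; move=> /(congr1 (@complex.Im R))/= -> /(congr1 (@complex.Im R))/= ->;
    rewrite !raddfD /=.
Qed.

Variables (phi dphi : R -> R).
Hypothesis Hphi : ode_solR q lam phi dphi /\ phi 0 = 0 /\ dphi 0 = 1.

Let sphi : ode_solR q lam phi dphi. Proof. by case: Hphi. Qed.
Let phi0 : phi 0 = 0. Proof. by case: Hphi => _ []. Qed.
Let dphi0 : dphi 0 = 1. Proof. by case: Hphi => _ []. Qed.

Lemma sol_multiple (y dy : R -> R) : ode_solR q lam y dy -> y 0 = 0 ->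
  forall t, 0 <= t <= 1 -> y t = dy 0 * phi t.
Proof.
move=> sy y0 t t01.
have sw := ode_solR_lin _ _ _ _ _ _ 1 (- dy 0) sy sphi.
have := sol_unique _ _ _ _ Hq sw; rewrite y0 phi0 dphi0.
move=> /(_ _ _ t t01) H; apply/eqP; rewrite -subr_eq0; apply/eqP.
by rewrite -[RHS]H; ring.
Qed.

Lemma ode_solC_MtoC (u : R -> R[i]) (A : R[i]) :
  (forall t, 0 <= t <= 1 -> u t = A * toC (phi t)) -> ode_solC q lam u.
Proof.
move=> uA.
have in01 (x : R) : x \in @I01 R -> u x = A * toC (phi x).
  by rewrite inE /I01 /= in_itv/= => /uA.
case: sphi => [i1 [i2 h]].
have iZ (c : R) (f : R -> R) : mu.-integrable (@I01 R) (EFin \o f) ->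
    mu.-integrable (@I01 R) (EFin \o (fun x => c * f x)).
  by move=> fi; exact: (@integrableZl _ _ _ mu (@I01 R) (measurable_itv _) c _ fi).
have iZt (t c : R) (f : R -> R) : t <= 1 -> mu.-integrable (@I01 R) (EFin \o f) ->
    \int[mu]_(x in I0t t) (c * f x) = c * \int[mu]_(x in I0t t) f x.
  move=> t1 fi; rewrite RintegralZl//; first exact: measurable_itv.
  apply: integrableS fi => //; first exact: measurable_itv.
  exact: I0t_sub01.
(* [u] is prescribed on [[0, 1]] only, so its integrands are exchanged by agreement on the domain of
   integration, not by equality of functions. *)
have eR : {in @I01 R, (fun x => complex.Re A * ((q x - lam) * phi x)) =1
    (fun x => complex.Re (toC (q x - lam) * u x))}.
  by move=> x /in01 ->; rewrite Re_toCM Re_MtoC; ring.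
have eI : {in @I01 R, (fun x => complex.Im A * ((q x - lam) * phi x)) =1
    (fun x => complex.Im (toC (q x - lam) * u x))}.
  by move=> x /in01 ->; rewrite Im_toCM Im_MtoC; ring.
have dR : (fun x => complex.Re (A * toC (dphi x))) = (fun x => complex.Re A * dphi x).
  by apply/funext => x; rewrite Re_MtoC.
have dI : (fun x => complex.Im (A * toC (dphi x))) = (fun x => complex.Im A * dphi x).
  by apply/funext => x; rewrite Im_MtoC.
exists (fun x => A * toC (dphi x)); split; first by split; rewrite ?dR ?dI; exact: iZ.
split.
  split.
    apply: (@eq_integrable _ _ _ mu (@I01 R) (measurable_itv _)
      (EFin \o (fun x => complex.Re A * ((q x - lam) * phi x)))).
      by move=> x /eR /= ->.
    exact: iZ.
  apply: (@eq_integrable _ _ _ mu (@I01 R) (measurable_itv _)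
    (EFin \o (fun x => complex.Im A * ((q x - lam) * phi x)))).
    by move=> x /eI /= ->.
  exact: iZ.
move=> t t01; have t1 : t <= 1 by case/andP: t01.
have sub (x : R) : x \in I0t t -> x \in @I01 R.
  by rewrite !inE; exact: I0t_sub01.
rewrite /cint dR dI !iZt//.
rewrite -(@eq_Rintegral _ _ _ mu (I0t t) _ _ (fun x xt => eR x (sub x xt))).
rewrite -(@eq_Rintegral _ _ _ mu (I0t t) _ _ (fun x xt => eI x (sub x xt))).
rewrite !iZt// !uA ?lexx ?ler01//.
have [-> ->] := h t t01.
by split; apply: complexP; rewrite raddfD /= ?Re_MtoC ?Im_MtoC; ring.
Qed.

Lemma ode_solC_multiple (u : R -> R[i]) : ode_solC q lam u -> u 0 = 0 ->
  exists A, forall t, 0 <= t <= 1 -> u t = A * toC (phi t).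
Proof.
move=> /ode_solC_split[dy [dz [sy sz]]] u0.
exists (Complex (dy 0) (dz 0)) => t t01; apply: complexP; rewrite ?Re_MtoC ?Im_MtoC /=.
- by rewrite (sol_multiple _ _ sy)// u0.
- by rewrite (sol_multiple _ _ sz)// u0.
Qed.

Lemma rderivR_multiple (y : R -> R) (r : R) :
  (forall t, 0 <= t <= 1 -> y t = r * phi t) -> rderivR y = r.
Proof.
move=> yr; suff H : (y h - y 0) / h @[h --> 0^'+] --> r by exact: (cvg_lim (@Rhausdorff R) H).
have H : r * ((phi h - phi 0) / h) @[h --> 0^'+] --> r * dphi 0.
  by apply: cvgM; [exact: cvg_cst|exact: sol_right_derivative sphi].
rewrite dphi0 mulr1 in H; apply: cvg_trans H; apply: near_eq_cvg; near=> h.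
have h0 : 0 < h by near: h; exact: nbhs_right_gt.
have h1 : h <= 1 by near: h; apply: nbhs_right_le.
by rewrite !yr ?lexx ?ler01 ?h1 ?ltW// mulrA mulrBr.
Unshelve. all: by end_near. Qed.

Lemma lderivR_multiple (y : R -> R) (r : R) :
  (forall t, 0 <= t <= 1 -> y t = r * phi t) -> lderivR y = r * dphi 1.
Proof.
move=> yr.
suff H : (y 1 - y (1 - h)) / h @[h --> 0^'+] --> r * dphi 1
  by exact: (cvg_lim (@Rhausdorff R) H).
have H : r * ((phi 1 - phi (1 - h)) / h) @[h --> 0^'+] --> r * dphi 1.
  by apply: cvgM; [exact: cvg_cst|exact: sol_left_derivative sphi].
apply: cvg_trans H; apply: near_eq_cvg; near=> h.
have h0 : 0 < h by near: h; exact: nbhs_right_gt.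
have h1 : h <= 1 by near: h; apply: nbhs_right_le.
rewrite (yr 1) ?lexx ?ler01// yr ?mulrA ?mulrBr//.
by rewrite subr_ge0 h1 gerBl ltW.
Unshelve. all: by end_near. Qed.

Lemma d0_multiple (u : R -> R[i]) (A : R[i]) :
  (forall t, 0 <= t <= 1 -> u t = A * toC (phi t)) -> d0 u = A.
Proof.
by move=> uA; apply: complexP; apply: rderivR_multiple => t /uA ->;
  rewrite ?Re_MtoC ?Im_MtoC.
Qed.

Lemma d1_multiple (u : R -> R[i]) (A : R[i]) :
  (forall t, 0 <= t <= 1 -> u t = A * toC (phi t)) -> d1 u = A * toC (dphi 1).
Proof.
by move=> uA; apply: complexP; rewrite ?Re_MtoC ?Im_MtoC; apply: lderivR_multiple => t /uA ->;
  rewrite ?Re_MtoC ?Im_MtoC.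
Qed.

End ComplexSolutions.

(** * The eigenspace *)

Section Eigenspace.
Context {R : realType}.
Local Notation mu := (@lebesgue_measure R).
Local Notation I := (@I01 R).

Local Hint Extern 0 (measurable (@I01 _)) => exact: measurable_itv : core.

Lemma in_I01 (x : R) : x \in I -> 0 <= x <= 1.
Proof. by rewrite inE /I01 /= in_itv. Qed.

Lemma EFin_Rintegral01 (g : R -> R) : mu.-integrable I (EFin \o g) ->
  (\int[mu]_(x in I) (g x)%:E = (\int[mu]_(x in I) g x)%R%:E)%E.
Proof. by move=> gi; rewrite /Rintegral fineK//; exact: integrable_fin_num. Qed.

Lemma Rintegral_lin01 (f g : R -> R) (a b : R) :
  mu.-integrable I (EFin \o f) -> mu.-integrable I (EFin \o g) ->
  \int[mu]_(x in I) (a * f x + b * g x) =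
  a * \int[mu]_(x in I) f x + b * \int[mu]_(x in I) g x.
Proof. by move=> fi gi; exact: (Rintegral_lin f g a b 1 (lexx 1) fi gi). Qed.

(** Stated for general [g]: [phi] serves the eigenfunction itself, [(q - lam) * phi] its second
    derivative. *)
Lemma fam_L2_multiple (f : gfam R) (A : int -> 'I_6 -> R[i]) (g : R -> R) :
  (forall n j t, 0 <= t <= 1 -> f n j t = A n j * toC (g t)) ->
  mu.-integrable I (EFin \o (fun x => g x * g x)) ->
  fam_L2 f <-> bounded_sums (fun p : int * 'I_6 =>
    sqnormC (A p.1 p.2) * \int[mu]_(x in I) (g x * g x)).
Proof.
move=> fA gi; rewrite -esum_lty_bounded; last first.
  move=> p; rewrite mulr_ge0 ?sqnormC_ge0// Rintegral_ge0// => x _.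
  by rewrite -expr2 sqr_ge0.
rewrite /fam_L2 (eq_esum (b := fun p : int * 'I_6 =>
   (sqnormC (A p.1 p.2) * \int[mu]_(x in I) (g x * g x))%:E))// => -[n j] _ /=.
rewrite -RintegralZl// -EFin_Rintegral01//; last first.
  exact: (@integrableZl _ _ _ mu I (measurable_itv _) _ _ gi).
apply: eq_integral => x /in_I01 x01.
by rewrite fA// sqnormCM sqnormC_toC expr2.
Qed.

Variables (q : R -> R) (lam : R).
Hypothesis Hq : L2_01 q.
Variables (phi dphi : R -> R).
Hypothesis Hphi : ode_solR q lam phi dphi /\ phi 0 = 0 /\ dphi 0 = 1.
Hypothesis Hlam : sigmaD q lam.

Let sphi : ode_solR q lam phi dphi. Proof. by case: Hphi. Qed.
Let phi0 : phi 0 = 0. Proof. by case: Hphi => _ []. Qed.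

(** A Dirichlet eigenfunction is [dy 0] times [phi], and [dy 0] is nonzero because the eigenfunction
    is nontrivial. *)
Lemma dirichlet_phi : phi 1 = 0 /\ exists2 t, 0 <= t <= 1 & phi t != 0.
Proof.
have [y [dy [sy [y0 [y1 [t [t01 yt]]]]]]] := Hlam.
have yE := sol_multiple _ _ Hq _ _ Hphi _ _ sy y0.
move: yt; rewrite yE// mulf_eq0 negb_or => /andP[dy0 pt]; split; last by exists t.
by move: y1; rewrite yE ?ler01 ?lexx// => /eqP; rewrite mulf_eq0 (negPf dy0) => /eqP.
Qed.

Let S := \int[mu]_(x in I) (phi x * phi x).
Let S0 : 0 < S.
Proof. by apply: (sol_square_pos _ _ _ _ sphi); case: dirichlet_phi. Qed.

(* The solution [v] with [v 0 = 1] that is orthogonal to [varphi] in [L^2], if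
   there is a solution not vanishing at [0], gives [K] and [c = v 1]. *)
Lemma vertex_controlR : exists c K : R, 0 < K /\ forall y dy, ode_solR q lam y dy ->
  y 1 = c * y 0 /\ K * y 0 ^+ 2 <= \int[mu]_(x in I) (y x * y x).
Proof.
have [phi1 _] := dirichlet_phi.
have [|no] := pselect (exists z dz, ode_solR q lam z dz /\ z 0 != 0); last first.
  (* All solutions vanish at 0 here, hence also at 1, so any [c] and any positive [K] would do. *)
  exists 0, 1; split=> // y dy sy.
  have y0 : y 0 = 0.
    by apply/eqP/negPn/negP => y0; apply: no; exists y, dy.
  rewrite (sol_multiple _ _ Hq _ _ Hphi _ _ sy y0) ?ler01 ?lexx// phi1 y0.
  rewrite !mulr0 expr0n mulr0; split=> //; apply: Rintegral_ge0 => x _.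
  by rewrite -expr2 sqr_ge0.
move=> [z [dz [sz z0]]].
pose a := (z 0)^-1; pose b := - (a * \int[mu]_(x in I) (z x * phi x)) / S.
have sv := ode_solR_lin _ _ _ _ _ _ a b sz sphi.
set v := (fun x => a * z x + b * phi x) in sv.
set dv := (fun x => _) in sv.
have v0 : v 0 = 1 by rewrite /v phi0 mulr0 addr0 mulVf.
have ipp := sol_product_integrable _ _ _ _ _ _ sphi sphi.
have ivp := sol_product_integrable _ _ _ _ _ _ sv sphi.
have ivv := sol_product_integrable _ _ _ _ _ _ sv sv.
have izp := sol_product_integrable _ _ _ _ _ _ sz sphi.
have vphi : \int[mu]_(x in I) (v x * phi x) = 0.
  rewrite (@eq_Rintegral _ _ _ mu I (fun x => a * (z x * phi x) + b * (phi x * phi x))).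
    rewrite Rintegral_lin01// -/S /b divfK ?gt_eqF// subrr //.
  by move=> x _; rewrite /v; ring.
exists (v 1), (\int[mu]_(x in I) (v x * v x)); split.
  by apply: (sol_square_pos _ _ _ _ sv); exists 0; rewrite ?lexx ?ler01// v0 oner_eq0.
move=> y dy sy.
have sw := ode_solR_lin _ _ _ _ _ _ 1 (- y 0) sy sv.
have w0 : 1 * y 0 + - y 0 * v 0 = 0 by rewrite v0; ring.
have [B yE'] : exists B, forall t, 0 <= t <= 1 -> 1 * y t + - y 0 * v t = B * phi t.
  by eexists; exact: (sol_multiple _ _ Hq _ _ Hphi _ _ sw w0).
have yE t : 0 <= t <= 1 -> y t = y 0 * v t + B * phi t.
  by move=> /yE' <-; ring.
split; first by rewrite yE ?lexx ?ler01// phi1; ring.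
rewrite (@eq_Rintegral _ _ _ mu I (fun x =>
  1 * (y 0 ^+ 2 * (v x * v x) + (2 * y 0 * B) * (v x * phi x)) + B ^+ 2 * (phi x * phi x))
  (fun x => y x * y x)); last first.
  by move=> x /in_I01 x01 /=; rewrite (yE x)//; ring.
rewrite Rintegral_lin01//; last exact: integrable_lin.
rewrite Rintegral_lin01// vphi -/S mulr0 addr0 mul1r mulrC lerDl.
by rewrite mulr_ge0 ?sqr_ge0// ltW.
Qed.

(** Real and imaginary parts share the constants [c] and [K]. The extended-real integral allows
    direct comparison with the terms of [fam_L2]. *)
Lemma vertex_control : exists c K : R, 0 < K /\ forall u, ode_solC q lam u ->
  u 1 = toC c * u 0 /\
  ((K * sqnormC (u 0))%:E <= \int[mu]_(x in I) (sqnormC (u x))%:E)%E.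
Proof.
have [c [K [K0 h]]] := vertex_controlR.
exists c, K; split=> // u /ode_solC_split[dy [dz [sy sz]]].
have [y1 yK] := h _ _ sy; have [z1 zK] := h _ _ sz; split.
  by apply: complexP; rewrite ?Re_toCM ?Im_toCM.
have iyy := sol_product_integrable _ _ _ _ _ _ sy sy.
have izz := sol_product_integrable _ _ _ _ _ _ sz sz.
have -> : (\int[mu]_(x in I) (sqnormC (u x))%:E = \int[mu]_(x in I)
  (1 * (complex.Re (u x) * complex.Re (u x)) + 1 * (complex.Im (u x) * complex.Im (u x)))%:E)%E.
  by apply: eq_integral => x _; rewrite /sqnormC !expr2 !mul1r.
rewrite EFin_Rintegral01; last exact: integrable_lin.
by rewrite lee_fin Rintegral_lin01// !mul1r /sqnormC mulrDr lerD.
Qed.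

Variables (N : nat) (a1 a2 : R) (k : 'I_N).
Let sk : R[i] := cexpi (2 * pi * k%:R / N%:R).

Lemma eigsp_vertex (f : gfam R) : eigsp q a1 a2 k lam f ->
  forall n j, f n j 0 = 0 /\ f n j 1 = 0.
Proof.
move=> [sol [L2f [_ bc]]].
have [c [K [K0 ctl]]] := vertex_control.
have f1 n j : f n j 1 = toC c * f n j 0 by have [] := ctl _ (sol n j).
have sum6 : bounded_sums (fun p : int * 'I_6 => K * sqnormC (f p.1 p.2 0)).
  apply/esum_lty_bounded; first by move=> p; rewrite mulr_ge0 ?sqnormC_ge0// ltW.
  apply: le_lt_trans L2f; apply: le_esum => -[n j] _ /=.
  by have [] := ctl _ (sol n j).
have sum1 : sq_summable (fun n => f n (ed 1) 0).
  have := bounded_sumsZ K^-1 _ _ (@bounded_sums_comp _ _ _ (fun n : int => (n, ed 1)) _ _ sum6).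
  rewrite invr_ge0 ltW// => /(_ isT) H.
  apply: bounded_sums_le (H _) => [n|n m []//].
  by rewrite /= mulrA mulVf ?mul1r// gt_eqF.
pose Nf n j := sqnormC (f n j 0).
(* The bracketed relations go around the cycle of edges 1 to 4. The last relation links cells
   through edge 5 of cell [n - 1], which starts where edge 2 of that cell starts and ends where edge
   1 of cell [n] starts. *)
have Nbc n : [/\ Nf n (ed 2) = c ^+ 2 * Nf n (ed 1), Nf n (ed 3) = c ^+ 2 * Nf n (ed 2),
    Nf n (ed 4) = c ^+ 2 * Nf n (ed 3) & Nf n (ed 1) = c ^+ 2 * Nf n (ed 4)] /\
    Nf n (ed 1) = c ^+ 2 * Nf (n - 1) (ed 2).
  have [[b1 b1'] [[b2 b2'] [[b3 b3'] [[b4 b4'] _]]]] := bc n.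
  rewrite /Nf; split; [split|].
  - by rewrite -b1 f1 !sqnormCM sqnormC_cexpi sqnormC_toC mul1r.
  - by rewrite -b2 f1 !sqnormCM sqnormC_cexpi sqnormC_toC mul1r.
  - by rewrite -b3 f1 !sqnormCM sqnormC_cexpi sqnormC_toC mul1r.
  - by rewrite -[in LHS]b4 f1 !sqnormCM !sqnormC_cexpi sqnormC_toC !mul1r.
  - rewrite b4' f1 !sqnormCM sqnormC_cexpi sqnormC_toC mul1r.
    by have [[_ <-] _] := bc (n - 1).
have z1 n : f n (ed 1) 0 = 0.
  apply/eqP/negPn/negP => fn0.
  have Nn0 : Nf n (ed 1) != 0.
    by apply: contra fn0 => /eqP/sqnormC_eq0 ->.
  have c8 : (c ^+ 2) ^+ 4 = 1.
    apply: (mulIf Nn0); rewrite mul1r.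
    have [[e2 e3 e4 e1] _] := Nbc n.
    by rewrite [in RHS]e1 e4 e3 e2; ring.
  have c2 : c ^+ 2 = 1.
    apply/eqP; rewrite -(@eqrXn2 _ 4) ?sqr_ge0//; first by rewrite c8 expr1n.
  have step m : Nf m (ed 1) = Nf (m - 1) (ed 1).
    by have [_ ->] := Nbc m; have [[-> _ _ _] _] := Nbc (m - 1); rewrite c2 !mul1r.
  have cst m : Nf m (ed 1) = Nf 0 (ed 1).
    elim/int_rect: m => [//|m IH|m IH].
      by rewrite step -IH; congr Nf; lia.
    by rewrite -IH [RHS]step; congr Nf; lia.
  have := sq_summable_const (fun n => f n (ed 1) 0) (f n (ed 1) 0) _ sum1.
  move=> /(_ _)/wrap[m|/eqP]; last by rewrite (negPf fn0).
  by have := cst m; rewrite -(cst n).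
(* Edges 2, 3, 4 inherit the zero along the cycle; edges 5 and 6 start at the same vertices as edges
   2 and 3. *)
have z0 n j : f n j 0 = 0.
  have [[e2 e3 e4 _] _] := Nbc n.
  have [[_ b1] [[_ b2] _]] := bc n.
  have N1 : Nf n (ed 1) = 0 by rewrite /Nf z1 sqnormC0.
  rewrite N1 mulr0 in e2; rewrite e2 mulr0 in e3; rewrite e3 mulr0 in e4.
  move: j; apply: edP => //; try exact: sqnormC_eq0.
  - by rewrite -b1; exact: sqnormC_eq0.
  - by rewrite -b2; exact: sqnormC_eq0.
by move=> n j; rewrite f1 !z0 mulr0.
Qed.

(** Needed for psi'' in L^2. As [phi] is bounded, (q - lam)^2 <= 2 (q^2 + lam^2) reduces it to the
    integrability of q^2. *)
Lemma weighted_integrable :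
  mu.-integrable I (EFin \o (fun x => ((q x - lam) * phi x) * ((q x - lam) * phi x))).
Proof.
have [M M0 hM] := sol_bounded _ _ _ _ sphi.
have [mq _] := Hq; have iq2 := potential_sqr_integrable q Hq.
have mp := sol_measurable _ _ _ _ sphi.
have ib := integrable_lin _ _ (2 * M ^+ 2) (2 * M ^+ 2) iq2 (integrable_cst01 (lam ^+ 2)).
apply: le_integrable ib => //.
  apply/measurable_EFinP.
  by apply: measurable_funM; apply: measurable_funM => //; apply: measurable_funB.
move=> x; rewrite /I01 /= in_itv/= => /hM pM.
have pM2 : phi x ^+ 2 <= M ^+ 2.
  by rewrite -(real_normK (num_real (phi x))) ler_pXn2r ?nnegrE.
rewrite lee_fin [leLHS]ger0_norm; last by rewrite -expr2 sqr_ge0.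
have K0 : 0 <= 2 * M ^+ 2 by rewrite mulr_ge0 ?sqr_ge0.
rewrite [leRHS]ger0_norm; last by apply: addr_ge0; apply: mulr_ge0 => //; exact: sqr_ge0.
have -> : (q x - lam) * phi x * ((q x - lam) * phi x) = phi x ^+ 2 * (q x - lam) ^+ 2 by ring.
have -> : 2 * M ^+ 2 * q x ^+ 2 + 2 * M ^+ 2 * lam ^+ 2 = M ^+ 2 * (2 * (q x ^+ 2 + lam ^+ 2)) by ring.
apply: ler_pM => //; rewrite ?sqr_ge0//.
by have := sqr_ge0 (q x + lam); nra.
Qed.

(** Passage from eigenfunctions to amplitudes. The squared norm on an edge is the squared modulus of
    its amplitude times the fixed positive number [S], so square integrability on the graph is
    square summability of the amplitudes. *)
Lemma eigspP (f : gfam R) : eigsp q a1 a2 k lam f <->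
  exists A : int -> 'I_6 -> R[i],
  [/\ forall n j t, 0 <= t <= 1 -> f n j t = A n j * toC (phi t),
      forall j, sq_summable (A ^~ j) &
      kirchhoff (cexpi a1) (cexpi a2) sk (toC (dphi 1)) A].
Proof.
have ipp := sol_product_integrable _ _ _ _ _ _ sphi sphi.
split=> [Hf|[A [fA sA kA]]].
  have vz := eigsp_vertex f Hf.
  case: Hf => sol [L2f [_ bc]].
  have /choice[A hA] : forall p : int * 'I_6, exists A, forall t, 0 <= t <= 1 ->
     f p.1 p.2 t = A * toC (phi t).
    by move=> p; apply: (ode_solC_multiple _ _ Hq _ _ Hphi _ (sol _ _)); have [] := vz p.1 p.2.
  pose B n j := A (n, j).
  have fB n j t : 0 <= t <= 1 -> f n j t = B n j * toC (phi t).
    exact: (hA (n, j)).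
  exists B; split=> //.
    have /(fam_L2_multiple f B phi fB ipp) sum6 := L2f.
    move=> j.
    have := bounded_sumsZ S^-1 _ _ (@bounded_sums_comp _ _ _ (fun n : int => (n, j)) _ _ sum6).
    rewrite invr_ge0 ltW// => /(_ isT) H.
    apply: bounded_sums_le (H _) => [n|n m []//].
    by rewrite /= -/S mulrCA mulVf ?mulr1// gt_eqF.
  have dz n j := d0_multiple _ _ _ _ Hphi _ _ (fB n j).
  have dn n j := d1_multiple _ _ _ _ Hphi _ _ (fB n j).
  by move=> n; have [_ [_ [_ [_ [h1 [h2 [h3 h4]]]]]]] := bc n;
    rewrite -cexpiN; split; rewrite -?dn -?dz.
have sum6 : bounded_sums (fun p : int * 'I_6 => sqnormC (A p.1 p.2)).
  by apply: (bounded_sums_prod (fun n j => sqnormC (A n j))) => j; exact: sA.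
have sumc (r : R) : 0 <= r -> bounded_sums (fun p : int * 'I_6 => sqnormC (A p.1 p.2) * r).
  by move=> r0; under eq_fun do rewrite mulrC; exact: bounded_sumsZ.
split; first by move=> n j; apply: (ode_solC_MtoC _ _ _ _ Hphi _ (A n j)); exact: fA.
split; first by apply/(fam_L2_multiple f A phi fA ipp)/sumc/ltW.
split.
  apply/(fam_L2_multiple _ A (fun x => (q x - lam) * phi x)); last 2 first.
  - exact: weighted_integrable.
  - by apply: sumc; apply: Rintegral_ge0 => x _; rewrite -expr2 sqr_ge0.
  move=> n j t t01; rewrite fA//.
  by apply: complexP; rewrite ?Re_toCM ?Im_toCM ?Re_MtoC ?Im_MtoC; ring.
(* All endpoint values are 0, so the continuity conditions are trivial and the derivative conditions
   are [kirchhoff]. *)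
have [phi1 _] := dirichlet_phi.
have toC0 : toC 0 = 0 :> R[i] by [].
have f0 n j : f n j 0 = 0 by rewrite fA ?lexx ?ler01// phi0 toC0 mulr0.
have f1 n j : f n j 1 = 0 by rewrite fA ?lexx ?ler01// phi1 toC0 mulr0.
have dz n j := d0_multiple _ _ _ _ Hphi _ _ (fA n j).
have dn n j := d1_multiple _ _ _ _ Hphi _ _ (fA n j).
move=> n /=; have [h1 h2 h3 h4] := kA n.
rewrite !f0 !f1 !mulr0 !dz !dn; do !split => //.
by rewrite cexpiN.
Qed.

End Eigenspace.

(** * The coefficient map on amplitudes and its inverse *)

Section Coefficients.
Context {R : realType}.
Variables (N : nat) (a1 a2 : R) (k : 'I_N) (ph : R).
Let sk : R[i] := cexpi (2 * pi * k%:R / N%:R).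
Let e1 : R[i] := cexpi a1.
Let e2 : R[i] := cexpi a2.
Let p : R[i] := toC ph.
Let k1 := 1 - sk * (e1 * e2) ^+ 2 * p ^+ 2.
Let k2 := 1 - sk * (e1 * e2) ^+ 2 * p ^+ 4.
Let degenerate := (sin (pi * k%:R / N%:R + (a1 + a2)) == 0) && (ph ^+ 2 == 1).

Lemma cexpi_double_phase : cexpi (2 * (a1 + a2)) = (e1 * e2) ^+ 2.
Proof. by rewrite mulr2n mulrDl mul1r !cexpiD expr2. Qed.

(** Writes s^k e^{2ia} as e^{2ix} with x the argument of the sine in s_k, so that s_k = 0 means s^k
    e^{2ia} = 1. *)
Lemma phaseE : sk * (e1 * e2) ^+ 2 = cexpi (2 * (pi * k%:R / N%:R + (a1 + a2))).
Proof. by rewrite -cexpi_double_phase -cexpiD; congr cexpi; ring. Qed.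

(** [m = 1] and [m = 2] are the two kappas. If one vanished, taking squared moduli would give
    [ph ^+ 2 = 1], since the phase has modulus 1; then the phase itself would be 1, which is the
    degenerate case. *)
Lemma kappa_neq0 (m : nat) : (0 < m)%N -> ~~ degenerate ->
  1 - sk * (e1 * e2) ^+ 2 * p ^+ m.*2 != 0.
Proof.
move=> m0 nd; apply/negP; rewrite subr_eq0 => /eqP h; move/negP: nd; apply.
have p4 : (ph ^+ 2) ^+ m.*2 = 1.
  have : sqnormC (1 : R[i]) = 1 by rewrite /sqnormC /= expr1n expr0n addr0.
  rewrite {1}h sqnormCM phaseE sqnormC_cexpi mul1r -toCX sqnormC_toC.
  by rewrite -exprM mulnC exprM.
have p2 : ph ^+ 2 = 1.
  by apply/eqP; rewrite -(@eqrXn2 _ m.*2) ?sqr_ge0// ?double_gt0// p4 expr1n.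
rewrite /degenerate p2 eqxx andbT; apply/eqP/cexpi_double_eq1.
have pm : p ^+ m.*2 = 1 by rewrite -toCX -mul2n exprM p2 expr1n.
by rewrite -phaseE [RHS]h pm mulr1.
Qed.

Lemma degenerateP : degenerate -> sk * (e1 * e2) ^+ 2 = 1 /\ p ^+ 2 = 1.
Proof.
move=> /andP[/eqP s0 /eqP p2]; split; last by rewrite -toCX p2.
by rewrite phaseE cexpi_double_sin0.
Qed.

(** This is [fhat] with derivatives at 0 replaced by amplitudes, which agree because varphi'(0) =
    1. *)
Definition edge_coef (A : int -> 'I_6 -> R[i]) (nu : 'I_2) (n : int) : R[i] :=
  if degenerate then A n (if nu == ord0 then ed 1 else ed 2) else
  if nu == ord0 then (A n (ed 5) + sk * p * (e1 * e2 * e1) * A n (ed 6)) / (k1 * k2)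
  else - ((e1 * A n (ed 6) + p * (e1 * e2) * A n (ed 5)) / (k1 * k2)).

Lemma fhatE (f : gfam R) (A : int -> 'I_6 -> R[i]) :
  (forall n j, d0 (f n j) = A n j) -> fhat a1 a2 k ph f = edge_coef A.
Proof.
move=> dA; apply/funext => nu; apply/funext => n.
rewrite /fhat /edge_coef -/degenerate !dA cexpi_double_phase !cexpiD !toCX.
by case: degenerate => //; case: (nu == ord0).
Qed.

Lemma edge_coef_linear (A B : int -> 'I_6 -> R[i]) (c d : R[i]) nu n :
  edge_coef (fun n j => c * A n j + d * B n j) nu n = c * edge_coef A nu n + d * edge_coef B nu n.
Proof.
rewrite /edge_coef; case: degenerate; case: (nu == ord0) => //.
  by move: (k1 * k2)^-1 => K; ring.
by move: (k1 * k2)^-1 => K; ring.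
Qed.

Lemma edge_coef_summable (A : int -> 'I_6 -> R[i]) nu :
  (forall j, sq_summable (A ^~ j)) -> sq_summable (edge_coef A nu).
Proof.
move=> sA; rewrite /edge_coef; case: degenerate; case: (nu == ord0) => //.
- under eq_fun do rewrite mulrC.
  by apply: sq_summableZ; apply: sq_summableD => //; exact: sq_summableZ.
- under eq_fun do rewrite mulrC -mulrN opprD -mulNr -mulNr.
  by apply: sq_summableZ; apply: sq_summableD; exact: sq_summableZ.
Qed.

(** [al j nu] and [be j nu] are the amplitudes of the generator [nu] on edge [j] of cells 0 and 1.
    The first clause yields the expansion and injectivity, the second surjectivity and the
    membership of the generators. *)
Lemma kirchhoff_reconstruction : exists al be : 'I_6 -> 'I_2 -> R[i],
  (forall A, kirchhoff e1 e2 sk p A -> (forall j, sq_summable (A ^~ j)) ->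
   forall n j, A n j = \sum_(nu < 2) (al j nu * edge_coef A nu n + be j nu * edge_coef A nu (n - 1))) /\
  (forall (c : 'I_2 -> int -> R[i])
     (A := fun n j => \sum_(nu < 2) (al j nu * c nu n + be j nu * c nu (n - 1))),
     kirchhoff e1 e2 sk p A /\ edge_coef A = c).
Proof.
have e10 : e1 != 0 := cexpi_neq0 a1; have e20 : e2 != 0 := cexpi_neq0 a2.
pose rec := if degenerate then edge_degenerate e1 e2 p else edge_generic e1 e2 sk p.
have rec_lin u v u' v' j : rec u v u' v' j = rec 1 0 0 0 j * u + rec 0 1 0 0 j * v +
   rec 0 0 1 0 j * u' + rec 0 0 0 1 j * v'.
  by rewrite /rec; case: degenerate; [exact: edge_degenerate_linear|exact: edge_generic_linear].
pose al j (nu : 'I_2) := if nu == ord0 then rec 1 0 0 0 j else rec 0 1 0 0 j.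
pose be j (nu : 'I_2) := if nu == ord0 then rec 0 0 1 0 j else rec 0 0 0 1 j.
pose i1 : 'I_2 := lift ord0 ord0.
have sumE (c : 'I_2 -> int -> R[i]) n j :
    \sum_(nu < 2) (al j nu * c nu n + be j nu * c nu (n - 1)) =
    rec (c ord0 n) (c i1 n) (c ord0 (n - 1)) (c i1 (n - 1)) j.
  by rewrite !big_ord_recl big_ord0 /al /be /= [RHS]rec_lin -/i1; ring.
exists al, be; split=> [A kA sA n j|c].
  rewrite sumE /rec /edge_coef; case: ifPn => [/degenerateP[sE p2]|nd] /=.
    by rewrite [in LHS](kirchhoff_degenerate e1 e2 sk p A n).
  by rewrite [in LHS](kirchhoff_generic e1 e2 sk p A n)//;
    [exact: (kappa_neq0 1)|exact: (kappa_neq0 2)].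
have -> : (fun n j => \sum_(nu < 2) (al j nu * c nu n + be j nu * c nu (n - 1))) =
   (fun n => rec (c ord0 n) (c i1 n) (c ord0 (n - 1)) (c i1 (n - 1))).
  by apply/funext => n; apply/funext => j; exact: sumE.
have two (nu : 'I_2) : nu = if nu == ord0 then ord0 else i1.
  by apply/val_inj; case: nu => -[|[]].
rewrite /rec /edge_coef; case: ifPn => [/degenerateP[sE p2]|nd].
  split; first exact: (edge_degenerate_kirchhoff e1 e2 sk p (c ord0) (c i1)).
  apply/funext => nu; apply/funext => n.
  by rewrite [in RHS](two nu); case: (nu == ord0); rewrite /edge_degenerate tab6E.
split; first exact: (edge_generic_kirchhoff e1 e2 sk p (c ord0) (c i1)).
apply/funext => nu; apply/funext => n; rewrite [in RHS](two nu).
have [h1 h2] := generic_coefficients e1 e2 sk p (c ord0 n) (c i1 n) (c ord0 (n - 1)) (c i1 (n - 1))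
  e10 (kappa_neq0 1 isT nd) (kappa_neq0 2 isT nd).
by case: (nu == ord0).
Qed.

End Coefficients.

(** * Kronecker deltas and symmetric ranges of integers *)

Section DeltaSums.
Context {R : realType}.

Lemma bounded_sums_delta (T : eqType) (x : T) : @bounded_sums R T (fun y => (y == x)%:R).
Proof.
exists 1 => s us; rewrite -(@natr_sum R).
have -> : (\sum_(j <- s) (j == x) = count_mem x s)%N.
  by rewrite -sum1_count [RHS]big_mkcond; apply: eq_bigr => j _ /=; case: (j == x).
by rewrite count_uniq_mem//; case: (x \in s).
Qed.

Lemma sum_delta_seq (s : seq int) (m : int) (g : int -> R[i]) : uniq s -> m \in s ->
  \sum_(n <- s) g n * (n == m)%:R = g m.
Proof.
move=> us ms; rewrite (bigD1_seq m)//= eqxx mulr1 big1 ?addr0// => n /negPf ->.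
by rewrite mulr0.
Qed.

Lemma mem_symmetric_range (m : int) (K : nat) : (`|m| <= K)%N ->
  m \in [seq (i%:Z - K%:Z)%R | i <- iota 0 (K.*2.+1)].
Proof.
move=> mK; apply/mapP; exists (absz (m + K%:Z)); last by lia.
by rewrite mem_iota; lia.
Qed.

Lemma uniq_symmetric_range (K : nat) : uniq [seq (i%:Z - K%:Z)%R | i <- iota 0 (K.*2.+1)].
Proof. by rewrite map_inj_uniq ?iota_uniq// => i j; lia. Qed.

End DeltaSums.

Theorem theorem2p2 (R : realType) (N : nat) (HN : (1 <= N)%N)
  (q : R -> R) (Hq : L2_01 q) (a1 a2 : R) (k : 'I_N) (lam : R)
  (Hlam : sigmaD q lam)
  (phi dphi : R -> R)
  (Hphi : ode_solR q lam phi dphi /\ phi 0 = 0 /\ dphi 0 = 1) :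
  let a := a1 + a2 in
  let ph := dphi 1 in                       (* phi = varphi'(1, lam) *)
  let H := eigsp q a1 a2 k lam in
  let sk := @cexpi R (2 * pi * k%:R / N%:R) in (* s^k *)
  let s_k := sin (pi * k%:R / N%:R + a) in
  let chat := fhat a1 a2 k ph in
  (* (i) eigenfunctions vanish at all vertices *)
  (forall f, H f -> forall n j, f n j 0 = 0 /\ f n j 1 = 0) /\
  (* (ii) *)
  (exists psi : 'I_2 -> gfam R,
     (forall nu, H (psi nu)) /\
     (forall nu m j t, 0 <= t <= 1 -> m != 0 -> m != 1 -> psi nu m j t = 0) /\
     (forall nu n, H (eshift n (psi nu))) /\
     (forall f, H f ->
        (forall nu, l2Z (chat f nu)) /\
        forall m j t, 0 <= t <= 1 ->
          ((fun K : nat =>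
              complex.Re (\sum_(n <- [seq (i%:Z - K%:Z)%R | i <- iota 0 (K.*2.+1)])
                          \sum_(nu < 2) chat f nu n * eshift n (psi nu) m j t))
             @ \oo --> complex.Re (f m j t)) /\
          ((fun K : nat =>
              complex.Im (\sum_(n <- [seq (i%:Z - K%:Z)%R | i <- iota 0 (K.*2.+1)])
                          \sum_(nu < 2) chat f nu n * eshift n (psi nu) m j t))
             @ \oo --> complex.Im (f m j t)))) /\
  (~ (s_k = 0 /\ ph ^+ 2 = 1) ->
     1 - sk * cexpi (2 * a) * toC (ph ^+ 2) != 0 /\
     1 - sk * cexpi (2 * a) * toC (ph ^+ 4) != 0) /\
  (* f |-> chat f is a linear isomorphism H -> l^2 (+) l^2 *)
  (forall f g (c d : R[i]), H f -> H g ->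
     H (fun n j x => c * f n j x + d * g n j x) /\
     forall nu n, chat (fun n j x => c * f n j x + d * g n j x) nu n
                  = c * chat f nu n + d * chat g nu n) /\
  (forall f g, H f -> H g -> (forall nu n, chat f nu n = chat g nu n) -> fam_eq f g) /\
  (forall c : 'I_2 -> int -> R[i], (forall nu, l2Z (c nu)) ->
     exists f, H f /\ forall nu n, chat f nu n = c nu n).
Proof.
move=> a ph H sk s_k chat.
have HP := eigspP q lam Hq phi dphi Hphi Hlam N a1 a2 k.
pose coef := edge_coef N a1 a2 k ph.
have dA (f : gfam R) (A : int -> 'I_6 -> R[i]) :
    (forall n j t, 0 <= t <= 1 -> f n j t = A n j * toC (phi t)) -> chat f = coef A.
  by move=> fA; apply: fhatE => n j; exact: (d0_multiple _ _ _ _ Hphi _ _ (fA n j)).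
have l2P (c : int -> R[i]) : l2Z c <-> sq_summable c.
  by apply: esum_lty_bounded => n; exact: sqnormC_ge0.
have [al [be [rec1 rec2]]] := kirchhoff_reconstruction N a1 a2 k ph.
pose F (c : 'I_2 -> int -> R[i]) : gfam R := fun n j t =>
  (\sum_(nu < 2) (al j nu * c nu n + be j nu * c nu (n - 1))) * toC (phi t).
have HF c : (forall nu, sq_summable (c nu)) -> H (F c) /\ chat (F c) = c.
  move=> sc; have [kA cA] := rec2 c; split; last by rewrite (dA _ _ (fun n j t _ => erefl)).
  apply/HP; eexists; split; [by move=> n j t _| |exact: kA].
  move=> j; under eq_fun do rewrite !big_ord_recl big_ord0 addr0.
  by apply: sq_summableD; apply: sq_summableD; apply: sq_summableZ => //;
    exact: sq_summable_shift.
pose psi (nu : 'I_2) : gfam R := fun m j t =>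
  (al j nu * (m == 0)%:R + be j nu * (m == 1)%:R) * toC (phi t).
have shiftE nu n : eshift n (psi nu) = F (fun nu' m => (nu' == nu)%:R * (m == n)%:R).
  apply/funext => m; apply/funext => j; apply/funext => t; rewrite /eshift /psi /F.
  rewrite (bigD1 nu)//= big1 ?addr0 => [|i /negPf ->]; last by rewrite !mul0r !mulr0 addr0.
  rewrite eqxx !mul1r; congr ((_ * _%:R + _ * _%:R) * _); congr nat_of_bool; lia.
have Hshift nu n : H (eshift n (psi nu)).
  rewrite shiftE; apply: (HF _ _).1 => nu'; apply: sq_summableZ.
  apply: bounded_sums_le (bounded_sums_delta int n) => m.
  by case: (m == n); rewrite /sqnormC /= ?expr1n expr0n ?addr0.
have Hpsi nu : H (psi nu).
  have -> : psi nu = eshift 0 (psi nu) by apply/funext => m; rewrite /eshift subr0.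
  exact: Hshift.
split; first by move=> f; exact: (eigsp_vertex q lam Hq phi dphi Hphi Hlam).
split; [exists psi; split=> //; split; [|split=> //]|split; [|split; [|split]]].
- by move=> nu m j t _ /negPf m0 /negPf m1; rewrite /psi m0 m1 !mulr0 addr0 mul0r.
- move=> f /HP[A [fA sA kA]]; rewrite (dA f A fA).
  split; first by move=> nu; apply/l2P; exact: edge_coef_summable.
  move=> m j t t01.
  have sumE : \forall K \near \oo,
      \sum_(n <- [seq (i%:Z - K%:Z)%R | i <- iota 0 (K.*2.+1)])
        \sum_(nu < 2) coef A nu n * eshift n (psi nu) m j t = f m j t.
    (* On cell [m] only the shifts by [m] and [m - 1] contribute. From [|m| + 1] on, the range
       contains both, so the partial sums are eventually constant. *)
    exists (`|m|.+1)%N => // K /= mK.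
    rewrite exchange_big fA// (rec1 A kA sA) mulr_suml /=; apply: eq_bigr => nu _.
    have -> s : \sum_(n <- s) coef A nu n * eshift n (psi nu) m j t =
        al j nu * toC (phi t) * \sum_(n <- s) coef A nu n * (n == m)%:R +
        be j nu * toC (phi t) * \sum_(n <- s) coef A nu n * (n == m - 1)%:R.
      rewrite !mulr_sumr -big_split /=; apply: eq_bigr => n _; rewrite /eshift /psi.
      have -> : (m - n == 0) = (n == m) by lia.
      have -> : (m - n == 1) = (n == m - 1) by lia.
      by ring.
    rewrite !sum_delta_seq ?uniq_symmetric_range// ?mem_symmetric_range//; [|lia|lia].
    by rewrite -/coef; ring.
  split; apply: cvg_near_cst; near=> K; congr (_ _); near: K; exact: sumE.
- move=> nd; have nd' : ~~ ((s_k == 0) && (ph ^+ 2 == 1)).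
    by apply/negP => /andP[/eqP ? /eqP ?]; apply: nd.
  by rewrite cexpi_double_phase !toCX; split;
    [exact: (kappa_neq0 N a1 a2 k ph 1)|exact: (kappa_neq0 N a1 a2 k ph 2)].
- move=> f g c d /HP[A [fA sA kA]] /HP[B [gB sB kB]].
  have cfg n j t : 0 <= t <= 1 -> c * f n j t + d * g n j t = (c * A n j + d * B n j) * toC (phi t).
    by move=> t01; rewrite fA// gB//; ring.
  split.
    apply/HP; exists (fun n j => c * A n j + d * B n j); split=> //.
      by move=> j; apply: sq_summableD; exact: sq_summableZ.
    move=> n; have [A1 A2 A3 A4] := kA n; have [B1 B2 B3 B4] := kB n.
    have lin0 (x y z : R[i]) : x = 0 -> y = 0 -> z = c * x + d * y -> z = 0.
      by move=> -> -> ->; rewrite !mulr0 addr0.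
    by split; [apply: (lin0 _ _ _ A1 B1)|apply: (lin0 _ _ _ A2 B2)|apply: (lin0 _ _ _ A3 B3)
      |apply: (lin0 _ _ _ A4 B4)]; ring.
  by move=> nu n; rewrite (dA _ _ cfg) (dA f A fA) (dA g B gB) /coef edge_coef_linear.
- move=> f g /HP[A [fA sA kA]] /HP[B [gB sB kB]].
  rewrite (dA f A fA) (dA g B gB) => AB n j t t01.
  rewrite fA// gB// (rec1 A kA sA) (rec1 B kB sB); congr (_ * _).
  by apply: eq_bigr => nu _; rewrite -/coef !AB.
- move=> c sc; have [HFc cE] := HF c (fun nu => (l2P _).1 (sc nu)).
  by exists (F c); rewrite cE.
Unshelve. all: by end_near. Qed.
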